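(* Let $H_T f_{ex} = g_{ex}$ with $f_{ex}\in L^2(\mathcal F)$ and assume $\| f_{ex} \|_{L^2(\mathcal F)} \leq E$, where $E>0$. Consider the reconstruction of $f_{ex}$ from a noisy measurement $g\in L^2(\mathcal G)$ satisfying $\|g-g_{ex}\|_{L^2(\mathcal G)} \leq \delta$, $\delta>0$, and let $$\mathcal S = \left\{ f \in L^2(\mathcal F) : \|H_Tf-g\|_{L^2(\mathcal G)} \leq \delta \text{ and } \|f\|_{L^2(\mathcal F)} \leq E \right\}$$ be the set of admissible solutions. Then any algorithm that for given $\delta$, $E$ and $g$ computes a solution in $\mathcal S$ is a regularization method for the reconstruction on $(a_2,a_3-\mu)$. More precisely, for all sufficiently small $\delta$ and any two admissible solutions $f_a, f_b \in \mathcal S$, $$\| \chi_\mu (f_a - f_b) \|_{L^2(\mathcal F)} \leq \frac{ 2 \delta e^{\alpha N_\mu}}{A} + 2 E B_\mu \left( \frac{\delta}{A V_\mu E} \right)^{\beta_\mu / \alpha} \frac{\alpha}{(\alpha - \beta_\mu) \sqrt{e^{2 \beta_\mu}-1}},$$ where $V_\mu>0$ is a constant which depends only on $\alpha$ and $\beta_\mu$.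
   Context: Let $a_1<a_2<a_3<a_4$ be real numbers, $\mathcal F=(a_2,a_4)$, $\mathcal G=(a_1,a_3)$. The truncated Hilbert transform $H_T:L^2(\mathcal F)\to L^2(\mathcal G)$ is $$(H_Tf)(x)=\frac1\pi\,\mathrm{p.v.}\!\int_{a_2}^{a_4}\frac{f(y)}{y-x}\,dy,\qquad x\in(a_1,a_3).$$ Its singular system is $(u_n,v_n,\sigma_n)_{n\in\mathbb Z}$: $u_n\in L^2(\mathcal F)$ and $v_n\in L^2(\mathcal G)$ are normalized singular functions forming orthonormal bases of the two spaces, $H_Tu_n=\sigma_nv_n$, and $\sigma_n$ is ordered decreasingly in $n\in\mathbb Z$, with $\sigma_n\to1$ as $n\to-\infty$ and $\sigma_n\to0$ as $n\to\infty$. Put $P(x)=(x-a_1)(x-a_2)(x-a_3)(x-a_4)$, $K_-=\int_{a_1}^{a_2}\frac{dx}{\sqrt{-P(x)}}$, $K_+=\int_{a_2}^{a_3}\frac{dx}{\sqrt{P(x)}}$. The indexing of the singular system is such that, for some small $\zeta>0$, $\sigma_n=2e^{-n\pi K_+/K_-}(1+O(n^{-1/2+\zeta}))$ as $n\to\infty$. A small $\mu>0$ is fixed, and $\chi_\mu$ denotes (multiplication by) the characteristic function of $(a_2,a_3-\mu)$. Set $\alpha=\pi K_+/K_-$ and $\beta_\mu=\frac{\pi}{K_-}\int_{a_3-\mu}^{a_3}\frac{dt}{\sqrt{P(t)}}$ (so $\alpha>\beta_\mu>0$). The following properties are standing assumptions: (P1) $0<\sigma_n<1$; (P2) there are $N_0\in\mathbb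 N$ and a positive real $A$ $(A<2)$ such that $\sigma_n\ge Ae^{-\alpha n}$ for $n>N_0$; (P3) there are $N_\mu\in\mathbb N$ and a positive real $B_\mu$ such that $\|\chi_\mu u_n\|_{L^2(\mathcal F)}\le B_\mu e^{-\beta_\mu n}$ for $n>N_\mu$. $N_\mu$ is selected with $N_\mu>N_0$. An algorithm producing an estimate $f^\delta$ of $f_{ex}$ from $g$ is a regularization method for the reconstruction on $(a_2,a_3-\mu)$ if $\|\chi_\mu(f^\delta-f_{ex})\|_{L^2(\mathcal F)}\to0$ as $\delta\to0$. ''Sufficiently small $\delta$'' refers to a threshold depending on the fixed constants and $E$, but not on $g,f_a,f_b$. *)

(* Defs.v *)
From HB Require Import structures.
From mathcomp Require Import all_boot all_order all_algebra.
From mathcomp Require Import all_classical all_reals all_analysis.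

Set Implicit Arguments.
Unset Strict Implicit.
Unset Printing Implicit Defensive.

Import Order.TTheory GRing.Theory Num.Theory.
Import numFieldNormedType.Exports.

Local Open Scope classical_set_scope.
Local Open Scope ring_scope.

(* Elements of L^2(a, b) are represented by real functions on the whole line,
   identified through the measure [leb_on a b], which ignores their values
   outside of ]a, b[. *)
Definition leb_on (R : realType) (a b : R) :
    {measure set (measurableTypeR R) -> \bar R} :=
  mrestr (@lebesgue_measure R)
    (measurable_itv `]a, b[ : measurable (`]a, b[%classic : set (measurableTypeR R))).

Definition L2 (R : realType) (a b : R) : set (R -> R) :=
  [set f | f \in Lfun (leb_on a b) 2%:E].

(* The norm is extended real valued, so that a bound such as
   [(normL2 a b f <= c%:E)%E] also asserts finiteness. *)
Definition normL2 (R : realType) (a b : R) (f : R -> R) : \bar R :=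
  'N[leb_on a b]_2%:E [EFin \o f].

Definition ipL2 (R : realType) (a b : R) (f g : R -> R) : R :=
  \int[leb_on a b]_x (f x * g x).

Record orthonormal_basis (R : realType) (a b : R) (e : int -> R -> R) : Prop := {
  onb_L2 : forall n, L2 a b (e n);
  onb_orthonormal : forall m n, ipL2 a b (e m) (e n) = (m == n)%:R;
  onb_total : forall f, L2 a b f -> forall eps : R, 0 < eps ->
    exists (s : seq int) (c : int -> R),
      (normL2 a b (fun x => f x - \sum_(n <- s) c n * e n x)%R < eps%:E)%E }.

Definition is_pv (R : realType) (D : set R) (k : R -> R) (x l : R) : Prop :=
  \int[@lebesgue_measure R]_(y in D `\` ball x eps) k y @[eps --> 0^'+] --> l.

(* [h] represents the truncated Hilbert transform of [f], an element of
   L^2(a1, a3), when [f] is in L^2(a2, a4). It is a relation because the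
   principal value exists only almost everywhere. *)
Definition is_HT (R : realType) (a1 a2 a3 a4 : R) (f h : R -> R) : Prop :=
  L2 a1 a3 h /\
  {ae leb_on a1 a3, forall x, exists2 l,
    is_pv `]a2, a4[%classic (fun y => f y / (y - x)) x l & h x = pi^-1 * l}.

Section geometry.
Variables (R : realType) (a1 a2 a3 a4 : R).

Definition quarticP (x : R) : R := (x - a1) * (x - a2) * (x - a3) * (x - a4).

Definition Kminus : R :=
  \int[@lebesgue_measure R]_(x in `]a1, a2[%classic) (Num.sqrt (- quarticP x))^-1.

Definition Kplus : R :=
  \int[@lebesgue_measure R]_(x in `]a2, a3[%classic) (Num.sqrt (quarticP x))^-1.

Definition alphaHT : R := pi * Kplus / Kminus.

Definition betaHT (mu : R) : R :=
  pi / Kminus *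
  \int[@lebesgue_measure R]_(t in `]a3 - mu, a3[%classic) (Num.sqrt (quarticP t))^-1.

End geometry.

Record singular_system (R : realType) (a1 a2 a3 a4 : R)
    (u v : int -> R -> R) (sigma : int -> R) : Prop := {
  ss_u : orthonormal_basis a2 a4 u;
  ss_v : orthonormal_basis a1 a3 v;
  ss_HT : forall n, is_HT a1 a2 a3 a4 (u n) (fun x => sigma n * v n x);
  ss_decreasing : {homo sigma : m n / m <= n >-> n <= m};
  ss_cvg1 : (fun n : nat => sigma (- n%:Z)) @ \oo --> (1 : R);
  ss_cvg0 : (fun n : nat => sigma n%:Z) @ \oo --> (0 : R);
  (* sigma_n = 2 e^(- n alpha) (1 + O(n^(-1/2 + zeta))), which fixes the
     indexing by int *)
  ss_asymptotic : exists2 zeta : R, 0 < zeta < 2^-1 &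
    (fun n : nat =>
       sigma n%:Z / (2 * expR (- (n%:R * alphaHT a1 a2 a3 a4))) - 1 : R^o)
    =O_\oo (fun n : nat => n%:R `^ (- 2^-1 + zeta) : R^o) }.

Section reconstruction.
Variables (R : realType) (a1 a2 a3 a4 : R).

Definition admissible (delta E : R) (g : R -> R) : set (R -> R) :=
  [set f | [/\ L2 a2 a4 f,
    exists2 h, is_HT a1 a2 a3 a4 f h &
      (normL2 a1 a3 (fun x => h x - g x)%R <= delta%:E)%E &
    (normL2 a2 a4 f <= E%:E)%E]].

(* [f_ex] and [g_ex] are the exact solution and data, [g] is a measurement
   with noise level [delta]. *)
Definition measurement (delta E : R) (f_ex g_ex g : R -> R) : Prop :=
  [/\ L2 a2 a4 f_ex, is_HT a1 a2 a3 a4 f_ex g_ex,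
    (normL2 a2 a4 f_ex <= E%:E)%E, L2 a1 a3 g &
    (normL2 a1 a3 (fun x => g x - g_ex x)%R <= delta%:E)%E].

(* || chi_mu f || in L^2(a2, a4), chi_mu being the characteristic function of
   ]a2, a3 - mu[ *)
Definition norm_chi (mu : R) (f : R -> R) : \bar R :=
  normL2 a2 a4 (fun x => \1_(`]a2, a3 - mu[%classic) x * f x)%R.

(* An algorithm maps delta, E and g to an estimate of f_ex. Nothing is asked
   of it on data that have no admissible solution. *)
Definition computes_admissible (Alg : R -> R -> (R -> R) -> (R -> R)) : Prop :=
  forall delta E g, 0 < delta -> 0 < E -> L2 a1 a3 g ->
    admissible delta E g !=set0 -> admissible delta E g (Alg delta E g).

(* The noisy data [g delta] are an arbitrary family, so the convergence is
   uniform with respect to the noise. *)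
Definition regularization_method (mu : R)
    (Alg : R -> R -> (R -> R) -> (R -> R)) : Prop :=
  forall (E : R) (f_ex g_ex : R -> R) (g : R -> R -> R), 0 < E ->
    (forall delta, 0 < delta -> measurement delta E f_ex g_ex (g delta)) ->
    norm_chi mu (fun x => Alg delta E (g delta) x - f_ex x)
      @[delta --> 0^'+] --> 0%E.

End reconstruction.

(* Main.v *)
(** The Hilbert transform is bounded from [L2 a2 a4] to [L2 a1 a3]: the kernel
    1/t cut off at |t| < e differs from the conjugate Poisson kernel
    t/(t^2 + e^2) by at most the Poisson kernel e/(t^2 + e^2), and the squared
    norms of the images under these two Poisson kernels agree up to a multiple
    of the squared norm, uniformly in e; Fatou's lemma passes to the principal
    value.  Boundedness and the totality of the [u n] give
    <HT f, v n> = sigma n * <f, u n>.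

    For a difference f of two admissible solutions the coefficients c n of f
    satisfy sum (c n)^2 <= (2 E)^2 and sum (sigma n * c n)^2 <= (2 delta)^2.
    The modes n <= Nmu are controlled by the second bound, the modes n > Nmu by
    |c n| <= 2 E min(1, tau e^(alpha n)), tau = delta / (A E), and the decay
    e^(- beta n) of || chi_mu (u n) ||: summing geometric series on both sides
    of the cross-over n = - ln tau / alpha gives a multiple of
    tau^(beta / alpha), and V absorbs the factor. *)
Require Import Defs.
From HB Require Import structures.
From mathcomp Require Import all_boot all_order all_algebra.
From mathcomp Require Import all_classical all_reals all_analysis.
From mathcomp Require Import measurable_realfun ring lra zify.

Set Implicit Arguments.
Unset Strict Implicit.
Unset Printing Implicit Defensive.

Import Order.TTheory GRing.Theory Num.Theory.
Import numFieldNormedType.Exports.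

Local Open Scope classical_set_scope.
Local Open Scope ring_scope.

(** * Lebesgue measure on an interval *)

(** Why the two squared norms agree: their difference is the double integral of f(y) f(z) against
    the real part of the integral of 1/((x - y + ie)(x - z + ie)) over the output variable x. Both
    poles lie in the same half-plane, so this inner integral vanishes over the whole line; over an
    interval only boundary terms remain, and these stay bounded uniformly in e as long as the
    endpoints keep away from y and z. Since a3 lies inside the support of f, the output interval is
    enlarged until it surrounds that support with margin 1, which only increases the norm to be
    bounded. The singular system prescribes the transform on the [u n] only, and for a general f the
    principal value is merely an almost everywhere relation; boundedness carries the relation
    between coefficients from finite combinations to f. All expansions are finite sums over
    duplicate-free lists of indices, up to an error eps, with bounds independent of the list. *)

Section leb_on.
Variable R : realType.
Implicit Types (a b : R).
Local Notation mu := (@lebesgue_measure R).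

Let itv_lty a b : (mu `]a, b[%classic < +oo)%E.
Proof. by rewrite lebesgue_measure_itv/=; case: ifP => _; rewrite ?ltry// -EFinB ltry. Qed.

(* [leb_on a b] bundled as a finite measure, as required by Fubini's theorem. *)
Definition fleb_on a b : {finite_measure set (measurableTypeR R) -> \bar R} :=
  mfrestr (measurable_itv `]a, b[ : measurable (`]a, b[%classic : set (measurableTypeR R)))
      (itv_lty a b).

Lemma leb_onE a b : leb_on a b = fleb_on a b :> {measure set (measurableTypeR R) -> \bar R}.
Proof. exact: eq_measure. Qed.

Lemma leb_on_setCitv a b : leb_on a b (~` `]a, b[%classic) = 0%E.
Proof. by rewrite /leb_on /= /mrestr setICl measure0. Qed.

Lemma leb_on_sub a b (A : set R) : A `<=` `]a, b[%classic ->
  leb_on a b A = mu A.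
Proof. by move=> Ab; rewrite /leb_on /= /mrestr; congr (mu _); apply/setIidPl. Qed.

Lemma integral_leb_on_itv a b (A : set R) (f : R -> \bar R) :
  A `<=` `]a, b[%classic ->
  (\int[leb_on a b]_(x in A) f x = \int[mu]_(x in A) f x)%E.
Proof.
move=> Ab; apply: eq_measure_integral => B mB BA.
by rewrite leb_on_sub//; exact: subset_trans Ab.
Qed.

Lemma ae_leb_on a b (P : R -> Prop) :
  (forall x, x \in `]a, b[ -> P x) -> {ae leb_on a b, forall x, P x}.
Proof.
move=> abP; exists (~` `]a, b[%classic); split.
- by apply: measurableC; exact: measurable_itv.
- exact: leb_on_setCitv.
- by move=> x /= nPx xab; apply: nPx; exact: abP.
Qed.

Lemma integral_leb_on a b (f : R -> \bar R) : measurable_fun setT f ->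
  (\int[leb_on a b]_x f x = \int[mu]_(x in `]a, b[) f x)%E.
Proof.
move=> mf; rewrite -(@integral_leb_on_itv a b)// [RHS]integral_mkcond.
have mab : measurable (`]a, b[%classic : set (measurableTypeR R)) by exact: measurable_itv.
apply: ae_eq_integral => //.
  by apply: (measurable_restrictT _ mab).1; apply: measurable_funS mf.
apply: ae_leb_on => x xab _.
by rewrite patchT// inE.
Qed.

(** The correlation bound proved below is available only for points of []a, b[], so monotonicity
    must not ask for the inequality on the whole line. *)
Lemma le_Rintegral_leb_on a b (f g : R -> R) :
  (leb_on a b).-integrable setT (EFin \o f) ->
  (leb_on a b).-integrable setT (EFin \o g) ->
  (forall x, x \in `]a, b[ -> f x <= g x) ->
  \int[leb_on a b]_x f x <= \int[leb_on a b]_x g x.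
Proof.
move=> fi gi fg; rewrite /Rintegral.
have mf := measurable_int _ fi; have mg := measurable_int _ gi.
rewrite !integral_leb_on// -!(@integral_leb_on_itv a b)//.
by apply: le_Rintegral => //; [exact: integrableS fi|exact: integrableS gi].
Qed.

Lemma leb_on_setT a b : (leb_on a b setT < +oo)%E.
Proof. by rewrite leb_onE ltey_eq fin_num_measure. Qed.

Lemma bounded_integrable_leb_on a b (f : R -> R) (M : R) :
  measurable_fun setT f -> (forall x, `|f x| <= M) ->
  (leb_on a b).-integrable setT (EFin \o f).
Proof.
move=> mf fM; apply: measurable_bounded_integrable => //; first exact: leb_on_setT.
by exists M; split; [exact: num_real|move=> y My x _; exact: le_trans (fM x) (ltW My)].
Qed.

End leb_on.

(** * Integral operators with a bounded kernel *)

Lemma integrable_boundedM d (T : measurableType d) (R : realType)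
    (mu : {measure set T -> \bar R}) (k f : T -> R) (M : R) :
  measurable_fun setT k -> (forall x, `|k x| <= M) ->
  mu.-integrable setT (EFin \o f) ->
  mu.-integrable setT (EFin \o (fun x => k x * f x)).
Proof.
move=> mk kM fi.
have mf : measurable_fun setT f by apply/measurable_EFinP; exact: measurable_int fi.
apply: (@le_integrable _ _ _ mu setT measurableT _ (EFin \o (fun x => M * f x))) => //.
- by apply/measurable_EFinP; exact: measurable_funM.
- move=> x _; rewrite /= lee_fin !normrM ler_wpM2r// (le_trans (kM x))// ler_norm//.
- by apply: (integrableZl measurableT M fi).
Qed.

Section bounded_kernel.
Context d1 d2 (T1 : measurableType d1) (T2 : measurableType d2) (R : realType).
Variables (m1 : {finite_measure set T1 -> \bar R}) (m2 : {finite_measure set T2 -> \bar R}).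

Definition kint (K : T2 * T1 -> R) (f : T1 -> R) (x : T2) : R :=
  \int[m1]_y (K (x, y) * f y).

Variables (K : T2 * T1 -> R) (M : R).
Hypotheses (mK : measurable_fun setT K) (KM : forall z, `|K z| <= M).

Lemma integrable_kernel (f : T1 -> R) x : m1.-integrable setT (EFin \o f) ->
  m1.-integrable setT (EFin \o (fun y => K (x, y) * f y)).
Proof.
apply: integrable_boundedM => //; exact: measurable_fun_pair2.
Qed.

(** This is the hypothesis of Fubini's theorem for the pairing of [g] with [kint K f]: the integrand
    is dominated by M |g(x)| |f(y)|, whose iterated integral is a product of two finite ones. *)
Lemma integrable_kernelM (f : T1 -> R) (g : T2 -> R) :
  m1.-integrable setT (EFin \o f) -> m2.-integrable setT (EFin \o g) ->
  (m2 \x m1)%E.-integrable setT (EFin \o (fun z => g z.1 * (K z * f z.2))).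
Proof.
move=> fi gi.
have mf : measurable_fun setT f by apply/measurable_EFinP; exact: measurable_int fi.
have mg : measurable_fun setT g by apply/measurable_EFinP; exact: measurable_int gi.
have mF : measurable_fun setT (fun z => g z.1 * (K z * f z.2)).
  apply: measurable_funM.
    exact: measurableT_comp mg measurable_fst.
  by apply: measurable_funM => //; exact: measurableT_comp mf measurable_snd.
apply/integrable12ltyP; first exact/measurable_EFinP.
have [_ foo] := integrableP _ _ _ fi.
have [_ goo] := integrableP _ _ _ gi.
pose A := (\int[m1]_y `|(f y)%:E|)%E.
have A0 : (0 <= A)%E by exact: integral_ge0.
(* A negative [M] contradicts [KM] at every point, so the integrands are vacuously zero. *)
have [M0|M0] := leP 0 M; last first.
  rewrite (eq_integral (fun=> 0%E)) ?integral0// => x _.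
  rewrite (eq_integral (fun=> 0%E)) ?integral0// => y _.
  by have := le_trans (normr_ge0 _) (KM (x, y)); rewrite leNgt M0.
apply: (@le_lt_trans _ _ (\int[m2]_x (`|(g x)%:E| * (M%:E * A)))%E).
  apply: ge0_le_integral => //=.
  - by move=> x _; exact: integral_ge0.
  - have mnF : measurable_fun setT (fun z => (`|g z.1 * (K z * f z.2)|%:E)%E).
      by apply/measurable_EFinP; apply: measurableT_comp.
    have nF0 z : (0 <= `|g z.1 * (K z * f z.2)|%:E)%E by rewrite lee_fin.
    exact: (measurable_fun_fubini_tonelli_F _ mnF nF0).
  - apply: emeasurable_funM => //; apply/measurable_EFinP.
    exact: measurableT_comp.
  move=> x _; rewrite muleA -ge0_integralZl//=; last 2 first.
    by apply/measurable_EFinP; apply: measurableT_comp.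
    by rewrite lee_fin mulr_ge0.
  apply: ge0_le_integral => //=.
  - apply/measurable_EFinP; apply: measurableT_comp => //.
    exact: measurable_fun_pair2 mF.
  - by apply/measurable_EFinP; apply: measurable_funM => //; apply: measurableT_comp.
  - move=> y _; rewrite lee_fin !normrM -mulrA ler_wpM2l// ler_wpM2r//.
rewrite ge0_integralZr//=.
  rewrite lte_mul_pinfty//; first exact: integral_ge0.
    by rewrite ge0_fin_numE//; exact: integral_ge0.
  by rewrite lte_mul_pinfty.
  by apply/measurable_EFinP; exact: measurableT_comp.
by rewrite mule_ge0.
Qed.

(** Measurability of the inner integral is a by-product of Fubini's theorem, taken with the constant
    1 as second function. *)
Lemma measurable_kint (f : T1 -> R) : m1.-integrable setT (EFin \o f) ->
  measurable_fun setT (kint K f).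
Proof.
move=> fi.
have ci : m2.-integrable setT (EFin \o (fun=> 1:R)).
  by apply: finite_measure_integrable_cst.
have := measurable_fubini_F (integrable_kernelM fi ci).
rewrite /fubini_F /= => h.
rewrite (_ : kint K f = fine \o (fun x : T2 => (\int[m1]_y (1 * (K (x, y) * f y))%:E)%E)).
  by apply: measurableT_comp => //; exact: measurable_fine.
apply/funext => x; rewrite /= /kint /Rintegral; congr fine.
by apply: eq_integral => y _; rewrite mul1r.
Qed.

Lemma normr_kint (f : T1 -> R) x : m1.-integrable setT (EFin \o f) ->
  `|kint K f x| <= M * \int[m1]_y `|f y|.
Proof.
move=> fi; have fKi := integrable_kernel x fi.
apply: (le_trans (le_normr_Rintegral _ fKi)) => //.
rewrite -RintegralZl//; last exact: integrable_norm fi.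
apply: le_Rintegral => //.
- exact: integrable_norm fKi.
- exact: (integrableZl measurableT M (integrable_norm fi)).
- by move=> y _; rewrite normrM ler_wpM2r.
Qed.

Lemma integrable_kint (f : T1 -> R) : m1.-integrable setT (EFin \o f) ->
  m2.-integrable setT (EFin \o kint K f).
Proof.
move=> fi; apply: measurable_bounded_integrable => //.
- by rewrite ltey_eq fin_num_measure.
- exact: measurable_kint.
- exists (M * \int[m1]_y `|f y|); split; first exact: num_real.
  by move=> y My x _; exact: le_trans (normr_kint _ fi) (ltW My).
Qed.

Lemma Rintegral_kint (f : T1 -> R) (g : T2 -> R) :
  m1.-integrable setT (EFin \o f) -> m2.-integrable setT (EFin \o g) ->
  \int[m2]_x (g x * kint K f x) =
  \int[m1]_y (f y * \int[m2]_x (K (x, y) * g x)).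
Proof.
move=> fi gi.
have mg : measurable_fun setT g by apply/measurable_EFinP; exact: measurable_int gi.
have Kgi y : m2.-integrable setT (EFin \o (fun x => K (x, y) * g x)).
  by apply: integrable_boundedM => //; exact: measurable_fun_pair1.
have := Fubini (integrable_kernelM fi gi) => /(congr1 fine) /= FE.
transitivity (fine (\int[m2]_x \int[m1]_y (g x * (K (x, y) * f y))%:E)).
  rewrite /Rintegral; congr fine; apply: eq_integral => x _.
  rewrite /kint EFinM fineK; last exact: integrable_fin_num (integrable_kernel x fi).
  rewrite -integralZl//; last exact: (integrable_kernel x fi).
rewrite FE /Rintegral; congr fine; apply: eq_integral => y _.
rewrite EFinM fineK; last exact: integrable_fin_num (Kgi y).
rewrite -integralZl//; last exact: (Kgi y).
by apply: eq_integral => x _; rewrite -EFinM; congr EFin; ring.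
Qed.

End bounded_kernel.

(** * The truncated Hilbert transform is bounded on L^2 *)

Section kernels.
Variable R : realType.
Implicit Types (e t a b : R).

(** [conj_poisson] and [poisson] are the real and imaginary parts of 1/(t - ie), without the
    customary factor 1/pi; the Poisson kernel thus has mass pi. *)
Definition conj_poisson e t : R := t * (t ^+ 2 + e ^+ 2)^-1.
Definition poisson e t : R := e * (t ^+ 2 + e ^+ 2)^-1.
Definition cut_inv e t : R := if `|t| < e then 0 else t^-1.

Lemma sqr_sum_gt0 e t : 0 < e -> 0 < t ^+ 2 + e ^+ 2.
Proof. by move=> e0; rewrite ltr_wpDl ?sqr_ge0// exprn_gt0. Qed.

Lemma poisson_ge0 e t : 0 < e -> 0 <= poisson e t.
Proof. by move=> e0; rewrite mulr_ge0 ?(ltW e0)// invr_ge0 ltW// sqr_sum_gt0. Qed.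

(** The bounds by 1/e blow up as [e] tends to 0: they serve measurability and integrability only,
    while the norm estimates come from other sources. *)
Lemma poisson_le e t : 0 < e -> poisson e t <= e^-1.
Proof.
move=> e0; have s0 := sqr_sum_gt0 t e0.
rewrite /poisson ler_pdivrMr// mulrDr expr2 [e ^+ 2]expr2 mulKf ?gt_eqF//.
by rewrite lerDr mulr_ge0 ?invr_ge0 ?(ltW e0)// -expr2 sqr_ge0.
Qed.

Lemma normr_poisson e t : 0 < e -> `|poisson e t| <= e^-1.
Proof. by move=> e0; rewrite ger0_norm ?poisson_ge0// poisson_le. Qed.

Lemma normr_conj_poisson e t : 0 < e -> `|conj_poisson e t| <= e^-1.
Proof.
move=> e0; have s0 := sqr_sum_gt0 t e0.
rewrite /conj_poisson normrM normfV (gtr0_norm s0) ler_pdivrMr//.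
rewrite mulrC ler_pdivlMr// -(real_normK (num_real t)).
by have := sqr_ge0 (`|t| - e); have := normr_ge0 t; nra.
Qed.

Lemma normr_cut_inv e t : 0 < e -> `|cut_inv e t| <= e^-1.
Proof.
move=> e0; rewrite /cut_inv; case: ltP => te.
  by rewrite normr0 invr_ge0 ltW.
by rewrite normfV lef_pV2// posrE (lt_le_trans e0).
Qed.

(** Inside the cut the left side is |t|/(t^2 + e^2) with |t| < e; outside, 1/t - t/(t^2 + e^2) =
    e^2/(t (t^2 + e^2)) and e <= |t|. *)
Lemma cut_inv_sub_conj_poisson e t : 0 < e ->
  `|cut_inv e t - conj_poisson e t| <= poisson e t.
Proof.
move=> e0; have s0 := sqr_sum_gt0 t e0.
rewrite /cut_inv; case: ltP => te.
  rewrite sub0r normrN /conj_poisson /poisson normrM normfV (gtr0_norm s0).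
  by rewrite ler_wpM2r ?invr_ge0 ?(ltW s0)// ltW.
have t0 : t != 0 by rewrite -normr_gt0 (lt_le_trans e0).
have -> : t^-1 - conj_poisson e t = e ^+ 2 / (t * (t ^+ 2 + e ^+ 2)).
  by rewrite /conj_poisson; field; rewrite t0 gt_eqF.
rewrite normrM normfV [`|t * _|]normrM (gtr0_norm s0) ger0_norm ?sqr_ge0//.
rewrite /poisson invfM mulrA ler_wpM2r ?invr_ge0 ?(ltW s0)//.
by rewrite ler_pdivrMr ?normr_gt0// expr2 ler_wpM2l// ltW.
Qed.

Lemma continuous_sqr_sum_inv e : 0 < e -> continuous (fun t => (t ^+ 2 + e ^+ 2)^-1).
Proof.
move=> e0 t; apply: cvgV; first by rewrite gt_eqF// sqr_sum_gt0.
by apply: cvgD; [exact: exprn_continuous|exact: cvg_cst].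
Qed.

Lemma continuous_poisson e : 0 < e -> continuous (poisson e).
Proof.
move=> e0 t; apply: cvgM; first exact: cvg_cst.
exact: continuous_sqr_sum_inv.
Qed.

Lemma continuous_conj_poisson e : 0 < e -> continuous (conj_poisson e).
Proof. by move=> e0 t; apply: cvgM => //; exact: continuous_sqr_sum_inv. Qed.

Lemma measurable_cut_inv e : 0 < e -> measurable_fun setT (cut_inv e).
Proof.
move=> e0; apply: measurable_fun_if => //.
- by apply: measurable_fun_ltr => //; exact: measurable_normr.
- rewrite setTI; apply: subspace_continuous_measurable_fun.
    rewrite (_ : _ @^-1` _ = ~` `]-e, e[%classic); last first.
      apply/seteqP; split=> t /=; rewrite in_itv/= -ltr_norml.
        by move=> ->.
      by case: ltP => //.
    by apply: measurableC; exact: measurable_itv.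
  apply: continuous_in_subspaceT => t /[!inE]/= /negbT.
  rewrite -leNgt => et; apply: inv_continuous.
  by rewrite -normr_gt0 (lt_le_trans e0).
Qed.

Definition conv_kernel (k : R -> R) (z : measurableTypeR R * measurableTypeR R) : R :=
  k (z.2 - z.1).

Lemma measurable_conv_kernel k : measurable_fun setT k ->
  measurable_fun setT (conv_kernel k).
Proof.
move=> mk; apply: (measurableT_comp mk).
by apply: measurable_funB; [exact: measurable_snd|exact: measurable_fst].
Qed.

Lemma Rintegral_leb_on_FTC2 (f F : R -> R) a b : a < b -> continuous f ->
  (forall x : R, is_derive x (1 : R) F (f x)) -> \int[leb_on a b]_x f x = F b - F a.
Proof.
move=> ab cf dF.
have mf : measurable_fun setT f by exact: continuous_measurable_fun.
have cF : continuous F.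
  move=> x; apply: differentiable_continuous; apply/derivable1_diffP.
  by have [] := dF x.
rewrite /Rintegral integral_leb_on; last exact/measurable_EFinP.
rewrite -[X in fine X](_ : (\int[lebesgue_measure]_(x in `[a, b]) (f x)%:E = _)%E); last first.
  rewrite -integral_itv_bndo_bndc ?integral_itv_obnd_cbnd//.
    by apply/measurable_EFinP; exact: measurable_funTS.
  by apply/measurable_EFinP; exact: measurable_funTS.
rewrite (@continuous_FTC2 _ f F)//.
- exact: continuous_subspaceT.
- split.
  + by move=> x _; have [] := dF x.
  + by apply: cvg_at_right_filter; exact: cF.
  + by apply: cvg_at_left_filter; exact: cF.
- by move=> x _; rewrite derive1E; have [_ ->] := dF x.
Qed.

(** The antiderivative arctan((x - s)/e) takes values between -pi/2 and pi/2, whatever [e]. *)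
Lemma Rintegral_poisson_le e a b s : 0 < e -> a < b ->
  \int[leb_on a b]_x poisson e (x - s) <= pi.
Proof.
move=> e0 ab.
pose F x := atan (e^-1 * (x - s)).
have -> : \int[leb_on a b]_x poisson e (x - s) = F b - F a.
  apply: Rintegral_leb_on_FTC2 => //.
    move=> x; apply: (@continuous_comp _ _ _ (fun x => x - s) (poisson e));
        last exact: continuous_poisson.
    by apply: cvgB => //; exact: cvg_cst.
  move=> x; have h : is_derive x (1 : R) (fun x => e^-1 * (x - s)) (e^-1).
    have -> : (fun x => e^-1 * (x - s)) = e^-1 \*: (id - cst s) by [].
    by apply: is_derive_eq; rewrite subr0 /GRing.scale/= mulr1.
  apply: is_derive_eq; rewrite /poisson; field.
  have := mulr_gt0 e0 e0; have := sqr_ge0 (x - s) => *.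
  by rewrite !gt_eqF//=; nra.
have := atan_ltpi2 (e^-1 * (b - s)); have := atan_gtNpi2 (e^-1 * (a - s)).
rewrite /F; lra.
Qed.

End kernels.

(** * Correlation integrals of the conjugate Poisson and Poisson kernels *)

Section correlation.
Variable R : realType.
Implicit Types (e t a b : R).

Lemma normr_lnB (A B : R) : 1 <= A -> 1 <= B -> `|ln A - ln B| <= `|A - B|.
Proof.
wlog AB : A B / B <= A => [h A1 B1|].
  have [BA|/ltW BA] := leP B A; first exact: h.
  by rewrite distrC [leRHS]distrC; apply: h.
move=> A1 B1; have A0 : 0 < A by lra. have B0 : 0 < B by lra.
rewrite !ger0_norm ?subr_ge0 ?ler_ln ?posrE//.
rewrite -ln_div ?posrE//.
have -> : A / B = 1 + (A - B) / B by field; rewrite gt_eqF.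
apply: (@le_trans _ _ ((A - B) / B)).
  by apply: le_ln1Dx; rewrite (@lt_le_trans _ _ 0)// ?ltrN10// mulr_ge0 ?invr_ge0
      ?subr_ge0// ltW.
by rewrite ler_pdivrMr// ler_peMr// subr_ge0.
Qed.

(* The real part of 1/((x - y + ie) (x - z + ie)), whence the logarithmic
   antiderivative. *)
Let corr e (y z x : R) : R :=
  conj_poisson e (y - x) * conj_poisson e (z - x) - poisson e (y - x) * poisson e (z - x).

Lemma continuous_corr e y z : 0 < e -> continuous (corr e y z).
Proof.
move=> e0 x.
have cB s (k : R -> R) : continuous k -> {for x, continuous (fun x => k (s - x))}.
  move=> ck; apply: (@continuous_comp _ _ _ (fun x => s - x) k); last exact: ck.
  by apply: cvgB => //; exact: cvg_cst.
by apply: cvgB; apply: cvgM; apply: cB;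
    (exact: continuous_poisson || exact: continuous_conj_poisson).
Qed.

Lemma is_derive_sqr_sum e y (x : R) : is_derive x (1 : R) (fun x => (x - y) ^+ 2 + e ^+ 2)
    (2 * (x - y)).
Proof.
have -> : (fun x => (x - y) ^+ 2 + e ^+ 2) = ((id - cst y) ^+ 2 + cst (e ^+ 2)) by [].
apply: is_derive_eq.
by rewrite /= subr0 addr0 /GRing.scale/= expr1 mulr1 mulr_natl.
Qed.

(** Partial fractions: the product of the two simple poles is 1/(y - z) times the difference of 1/(x
    - y + ie) and 1/(x - z + ie), whose real parts are halves of logarithmic derivatives. *)
Lemma Rintegral_corr_neq e c d y z : 0 < e -> c < d -> y != z ->
  \int[leb_on c d]_x corr e y z x =
  (2 * (y - z))^-1 * (ln ((d - y) ^+ 2 + e ^+ 2) - ln ((d - z) ^+ 2 + e ^+ 2)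
  - (ln ((c - y) ^+ 2 + e ^+ 2) - ln ((c - z) ^+ 2 + e ^+ 2))).
Proof.
move=> e0 cd yz.
pose F x := (2 * (y - z))^-1 * (ln ((x - y) ^+ 2 + e ^+ 2) - ln ((x - z) ^+ 2 + e ^+ 2)).
transitivity (F d - F c); last by rewrite /F -mulrBr.
apply: Rintegral_leb_on_FTC2 => //; first exact: continuous_corr.
move=> x.
have dln s : is_derive x (1:R) (fun x => ln ((x - s) ^+ 2 + e ^+ 2)) (((x - s) ^+ 2 + e ^+
    2)^-1 * (2 * (x - s))).
  have h1 := is_derive_sqr_sum e s x.
  have h2 := is_derive1_ln (sqr_sum_gt0 (x - s) e0).
  exact: (@is_derive1_comp _ (@ln R) (fun x => (x - s) ^+ 2 + e ^+ 2) x _ _ h2 h1).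
have -> : F = (2 * (y - z))^-1 \*: ((fun x => ln ((x - y) ^+ 2 + e ^+ 2)) - (fun x => ln
    ((x - z) ^+ 2 + e ^+ 2))) by [].
have h1 := dln y; have h2 := dln z.
apply: is_derive_eq; rewrite /corr /poisson /conj_poisson /GRing.scale/=.
field.
have h3 := sqr_sum_gt0 (x - y) e0. have h4 := sqr_sum_gt0 (x - z) e0.
have h5 := sqr_sum_gt0 (y - x) e0. have h6 := sqr_sum_gt0 (z - x) e0.
by rewrite !(gt_eqF h3, gt_eqF h4, gt_eqF h5, gt_eqF h6) subr_eq0 yz.
Qed.

(** On the diagonal the integrand is the real part of 1/(x - y + ie)^2, with antiderivative the real
    part of -1/(x - y + ie). *)
Lemma Rintegral_corr_eq e c d y : 0 < e -> c < d ->
  \int[leb_on c d]_x corr e y y x =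
  conj_poisson e (c - y) - conj_poisson e (d - y).
Proof.
move=> e0 cd; pose F x := - conj_poisson e (x - y).
transitivity (F d - F c); last by rewrite /F opprK addrC.
apply: Rintegral_leb_on_FTC2 => //; first exact: continuous_corr.
move=> x.
have h1 := is_derive_sqr_sum e y x.
have h3 := sqr_sum_gt0 (x - y) e0.
have h2 := @is_deriveV _ (fun x => (x - y) ^+ 2 + e ^+ 2) x _ 1 (lt0r_neq0 h3) h1.
have -> : F = - ((id - cst y) * (fun x => ((x - y) ^+ 2 + e ^+ 2)^-1)) by [].
apply: is_derive_eq; rewrite /corr /poisson /conj_poisson /GRing.scale/=.
have h5 := sqr_sum_gt0 (y - x) e0.
have -> : (id - cst y) x = x - y by [].
field.
by rewrite !(gt_eqF h3, gt_eqF h5).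
Qed.

(** The margin 1 keeps the arguments of the logarithms at least 1, where ln is 1-Lipschitz. Hence
    each endpoint t contributes at most |(t - y)^2 - (t - z)^2| <= 2 (d - c) |y - z|, and the factor
    |y - z| cancels the denominator 2 |y - z|. On the diagonal the two boundary terms are at most 1
    each. *)
Lemma normr_Rintegral_corr e a b c d y z : 0 < e -> c <= a - 1 -> b + 1 <= d ->
  y \in `]a, b[ -> z \in `]a, b[ ->
  `|\int[leb_on c d]_x corr e y z x| <= 2 * (d - c).
Proof.
move=> e0 ca bd; rewrite !in_itv/= => /andP[ay yb] /andP[az zb].
have cd : c < d by lra.
have [<-|yz] := eqVneq y z.
  rewrite Rintegral_corr_eq//.
  have qle t : 1 <= `|t| -> `|conj_poisson e t| <= 1.
    move=> t1; have h3 := sqr_sum_gt0 t e0.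
    rewrite /conj_poisson normrM normfV (gtr0_norm h3) ler_pdivrMr// mul1r.
    by rewrite -(real_normK (num_real t)); have := sqr_ge0 e; nra.
  apply: (le_trans (ler_normB _ _)).
  have h1 := qle (c - y) ltac:(rewrite ler0_norm; lra).
  have h2 := qle (d - y) ltac:(rewrite ger0_norm; lra).
  lra.
rewrite Rintegral_corr_neq// normrM normfV mulrC ler_pdivrMr; last first.
  by rewrite normr_gt0 mulf_neq0// ?subr_eq0// pnatr_eq0.
have lnle t : 1 <= `|t - y| <= d - c -> 1 <= `|t - z| <= d - c ->
  `|ln ((t - y) ^+ 2 + e ^+ 2) - ln ((t - z) ^+ 2 + e ^+ 2)| <= 2 * (d - c) * `|y - z|.
  move=> /andP[y1 y2] /andP[z1 z2].
  apply: (le_trans (normr_lnB _ _)).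
  - by rewrite -(real_normK (num_real (t - y))); have := sqr_ge0 e; nra.
  - by rewrite -(real_normK (num_real (t - z))); have := sqr_ge0 e; nra.
  have -> : (t - y) ^+ 2 + e ^+ 2 - ((t - z) ^+ 2 + e ^+ 2) = ((t - y) + (t - z)) * (z - y)
      by ring.
  rewrite normrM [`|z - y|]distrC ler_wpM2r//.
  by apply: (le_trans (ler_normD _ _)); lra.
apply: (le_trans (ler_normB _ _)).
rewrite normrM ger0_norm ?ler0n//.
have -> : 2 * (d - c) * (2 * `|y - z|) = 2 * (d - c) * `|y - z| + 2 * (d - c) * `|y - z| by
    ring.
by apply: lerD; apply: lnle;
    rewrite ?(ler0_norm (_ : c - _ <= 0)) ?(ger0_norm (_ : 0 <= d - _)); lra.
Qed.

End correlation.

(** Cauchy-Schwarz for a weight of mass at most [m]: expand the nonnegative integral of w (f - t)^2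
    at t = S/m, the minimiser of t^2 m - 2 t S. *)
Lemma weighted_Jensen d (T : measurableType d) (R : realType)
    (mu : {finite_measure set T -> \bar R}) (w f : T -> R) (M m : R) :
  measurable_fun setT w -> (forall x, 0 <= w x) -> (forall x, w x <= M) ->
  mu.-integrable setT (EFin \o f) ->
  mu.-integrable setT (EFin \o (fun x => f x ^+ 2)) ->
  0 < m -> \int[mu]_x w x <= m ->
  (\int[mu]_x (w x * f x)) ^+ 2 <= m * \int[mu]_x (w x * f x ^+ 2).
Proof.
move=> mw w0 wM fi f2i m0 wm.
have wM' x : `|w x| <= M by rewrite ger0_norm.
have iwf := integrable_boundedM mw wM' fi.
have iwf2 := integrable_boundedM mw wM' f2i.
have c1 : mu.-integrable setT (EFin \o (fun=> 1:R)) by apply: finite_measure_integrable_cst.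
have iw : mu.-integrable setT (EFin \o w).
  by apply: eq_integrable (integrable_boundedM mw wM' c1) => //= x _; rewrite mulr1.
set S := \int[mu]_x (w x * f x).
pose t := S / m.
have ip1 : mu.-integrable setT (EFin \o (fun x => (2 * t) * (w x * f x))).
  exact: (integrableZl measurableT (2 * t) iwf).
have ip2 : mu.-integrable setT (EFin \o (fun x => t ^+ 2 * w x)).
  exact: (integrableZl measurableT (t ^+ 2) iw).
have ip3 : mu.-integrable setT (EFin \o (fun x => w x * f x ^+ 2 - (2 * t) * (w x * f x))).
  exact: (integrableB measurableT iwf2 ip1).
have : 0 <= \int[mu]_x (w x * f x ^+ 2 - (2 * t) * (w x * f x) + t ^+ 2 * w x).
  apply: Rintegral_ge0 => x _.
  have -> : w x * f x ^+ 2 - (2 * t) * (w x * f x) + t ^+ 2 * w x = w x * (f x - t) ^+ 2 by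
      ring.
  by rewrite mulr_ge0// sqr_ge0.
rewrite RintegralD// RintegralB// !RintegralZl// -/S => h.
have h2 : t ^+ 2 * \int[mu]_x w x <= t ^+ 2 * m by rewrite ler_wpM2l// sqr_ge0.
have h3 : S ^+ 2 / m <= \int[mu]_x (w x * f x ^+ 2).
  have e1 : 2 * t * S = 2 * (S ^+ 2 / m) by rewrite /t; ring.
  have e2 : t ^+ 2 * m = S ^+ 2 / m by rewrite /t; field; rewrite gt_eqF.
  lra.
by move: h3; rewrite ler_pdivrMr// mulrC.
Qed.

(** * The quadratic form of an integral operator *)

Section kint_sqr.
Context d1 d2 (T1 : measurableType d1) (T2 : measurableType d2) (R : realType).
Variables (m1 : {finite_measure set T1 -> \bar R}) (m2 : {finite_measure set T2 -> \bar R}).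
Variables (K : T2 * T1 -> R) (M : R).
Hypotheses (mK : measurable_fun setT K) (KM : forall z, `|K z| <= M).
Variable f : T1 -> R.
Hypothesis fi : m1.-integrable setT (EFin \o f).

(** The kernel of the adjoint of [K] composed with [K]. *)
Let K' (y : T1) (z : T1) := \int[m2]_x (K (x, z) * K (x, y)).

Lemma integrable_kint_sqr :
  m2.-integrable setT (EFin \o (fun x => kint m1 K f x ^+ 2)).
Proof.
have := integrable_boundedM (measurable_kint m2 mK KM fi) (fun x => normr_kint mK KM x fi)
  (integrable_kint m2 mK KM fi).
by apply: eq_integrable => //= x _; rewrite expr2.
Qed.

Let iK y : m2.-integrable setT (EFin \o (fun x => K (x, y))).
Proof.
apply: measurable_bounded_integrable => //.
- by rewrite ltey_eq fin_num_measure.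
- exact: measurable_fun_pair1 mK.
- by exists M; split; [exact: num_real|move=> z Mz x _; exact: le_trans (KM _) (ltW Mz)].
Qed.

(** The kernel of the adjoint operator. [K' y] and the integral of f against it are images under
    this operator, whence their integrability. *)
Let Ks (z : T1 * T2) := K (z.2, z.1).

Let mKs : measurable_fun setT Ks.
Proof.
apply: (measurableT_comp mK).
by apply/measurable_fun_pair; [exact: measurable_snd|exact: measurable_fst].
Qed.

Let KsM z : `|Ks z| <= M. Proof. exact: KM. Qed.

Lemma integrable_kint_corr y : m1.-integrable setT (EFin \o (fun z => f z * K' y z)).
Proof.
have := integrable_boundedM (measurable_kint m1 mKs KsM (iK y))
  (fun x => normr_kint mKs KsM x (iK y)) fi.
by apply: eq_integrable => //= z _; rewrite mulrC.
Qed.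

Lemma Rintegral_kint_corr y :
  \int[m2]_x (K (x, y) * kint m1 K f x) = \int[m1]_z (f z * K' y z).
Proof. exact (Rintegral_kint mK KM fi (iK y)). Qed.

Lemma integrable_kint_quad :
  m1.-integrable setT (EFin \o (fun y => f y * \int[m1]_z (f z * K' y z))).
Proof.
have ik := integrable_kint m2 mK KM fi.
have := integrable_boundedM (measurable_kint m1 mKs KsM ik)
  (fun x => normr_kint mKs KsM x ik) fi.
by apply: eq_integrable => //= y _; rewrite mulrC -Rintegral_kint_corr.
Qed.

(** The squared norm of K f is the pairing of f with the adjoint applied to K f; Fubini is used
    twice. Comparing the norms of two images is thereby reduced to comparing the kernels [K']. *)
Lemma Rintegral_kint_sqr :
  \int[m2]_x (kint m1 K f x ^+ 2) = \int[m1]_y (f y * \int[m1]_z (f z * K' y z)).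
Proof.
under eq_Rintegral do rewrite expr2.
rewrite (Rintegral_kint mK KM fi (integrable_kint m2 mK KM fi)).
by apply: eq_Rintegral => y _; rewrite Rintegral_kint_corr.
Qed.

End kint_sqr.

(** * Bounds uniform in the cut-off parameter *)

Section truncated_kernels.
Variable R : realType.
Variables (a b c d e : R) (f : R -> R).
Hypotheses (ab : a < b) (ca : c <= a - 1) (bd : b + 1 <= d) (e0 : 0 < e).
Local Notation m1 := (fleb_on a b).
Local Notation m2 := (fleb_on c d).
Hypotheses (fi : m1.-integrable setT (EFin \o f))
  (f2i : m1.-integrable setT (EFin \o (fun x => f x ^+ 2))).

Let q := conv_kernel (@conj_poisson R e).
Let p := conv_kernel (@poisson R e).
Let k := conv_kernel (@cut_inv R e).

Let mq : measurable_fun setT q.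
Proof. by apply: measurable_conv_kernel; apply: continuous_measurable_fun;
    exact: continuous_conj_poisson. Qed.
Let mp : measurable_fun setT p.
Proof. by apply: measurable_conv_kernel; apply: continuous_measurable_fun;
    exact: continuous_poisson. Qed.
Let mk : measurable_fun setT k.
Proof. by apply: measurable_conv_kernel; exact: measurable_cut_inv. Qed.
Let qM z : `|q z| <= e^-1. Proof. exact: normr_conj_poisson. Qed.
Let pM z : `|p z| <= e^-1. Proof. exact: normr_poisson. Qed.
Let kM z : `|k z| <= e^-1. Proof. exact: normr_cut_inv. Qed.

(** The difference of the two quadratic forms has the integrated correlation as kernel, bounded by 2
    (d - c) on []a, b[]; this leaves the square of the L^1 norm of [f]. *)
Lemma Rintegral_conj_poisson_sqr_le :
  \int[m2]_x (kint m1 q f x ^+ 2) <=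
  \int[m2]_x (kint m1 p f x ^+ 2) + 2 * (d - c) * (\int[m1]_y `|f y|) ^+ 2.
Proof.
have fni : m1.-integrable setT (EFin \o (fun y => `|f y|)) by exact: integrable_norm fi.
have iq := integrable_kint_quad m2 mq qM fi.
have ip := integrable_kint_quad m2 mp pM fi.
rewrite -lerBlDl (Rintegral_kint_sqr _ mq qM fi) (Rintegral_kint_sqr _ mp pM fi).
rewrite -(RintegralB measurableT iq ip) expr2 mulrA -RintegralZl//.
apply: (@le_Rintegral_leb_on _ a b).
- exact (integrableB measurableT iq ip).
- exact (integrableZl measurableT _ fni).
move=> y yab.
have iqy := integrable_kint_corr m2 mq qM fi y.
have ipy := integrable_kint_corr m2 mp pM fi y.
rewrite -mulrBr -(RintegralB measurableT iqy ipy).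
apply: (le_trans (ler_norm _)); rewrite normrM mulrC ler_wpM2r//.
have iB := integrableB measurableT iqy ipy.
apply: (le_trans (le_normr_Rintegral measurableT iB)).
rewrite -RintegralZl//.
apply: (@le_Rintegral_leb_on _ a b).
- exact (integrable_norm iB).
- exact (integrableZl measurableT _ fni).
move=> z zab.
rewrite -mulrBr normrM mulrC ler_wpM2r//.
have iqq z1 z2 : m2.-integrable setT (EFin \o (fun x => q (x, z1) * q (x, z2))).
  apply: (@bounded_integrable_leb_on _ c d _ (e^-1 * e^-1)).
    by apply: measurable_funM; exact: measurable_fun_pair1 mq.
  by move=> x; rewrite normrM ler_pM.
have ipp z1 z2 : m2.-integrable setT (EFin \o (fun x => p (x, z1) * p (x, z2))).
  apply: (@bounded_integrable_leb_on _ c d _ (e^-1 * e^-1)).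
    by apply: measurable_funM; exact: measurable_fun_pair1 mp.
  by move=> x; rewrite normrM ler_pM.
rewrite -(RintegralB measurableT (iqq _ _) (ipp _ _)).
exact: (normr_Rintegral_corr e0 ca bd zab yab).
Qed.

(** Schur's test: the mass bound pi is used once in y, through Jensen, and once in x, after Fubini.
    The kernel is even ([psym]), so one mass bound serves both variables. *)
Lemma Rintegral_poisson_sqr_le :
  \int[m2]_x (kint m1 p f x ^+ 2) <= pi ^+ 2 * \int[m1]_y (f y ^+ 2).
Proof.
have cd : c < d by move: ab ca bd => *; lra.
have p0 z : 0 <= p z by exact: poisson_ge0.
have pi0 : (0 : R) < pi by exact: pi_gt0.
have psym (x y : R) : p (x, y) = poisson e (x - y).
  by rewrite /p /conv_kernel /poisson /= -sqrrN opprB.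
have J x : kint m1 p f x ^+ 2 <= pi * kint m1 p (fun y => f y ^+ 2) x.
  apply: (@weighted_Jensen _ _ _ m1 (fun y => p (x, y)) f e^-1) => //.
  - exact: measurable_fun_pair2 mp.
  - by move=> y; exact: le_trans (ler_norm _) (pM _).
  - exact: Rintegral_poisson_le.
have i1 := integrable_kint_sqr m2 mp pM fi.
have i2 := integrable_kint m2 mp pM f2i.
apply: (le_trans (le_Rintegral measurableT i1 (integrableZl measurableT pi i2) (fun x _ =>
    J x))).
rewrite RintegralZl// expr2 -mulrA ler_wpM2l ?(ltW pi0)//.
have c1 : m2.-integrable setT (EFin \o (fun=> 1:R)) by apply: finite_measure_integrable_cst.
have -> : \int[m2]_x kint m1 p (fun y => f y ^+ 2) x =
    \int[m1]_y (f y ^+ 2 * \int[m2]_x (p (x, y) * 1)).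
  rewrite -(Rintegral_kint mp pM f2i c1).
  by apply: eq_Rintegral => x _; rewrite mul1r.
rewrite -RintegralZl//; apply: le_Rintegral => //.
- have := integrable_boundedM (measurable_kint m1 mp pM c1)
    (fun x => normr_kint mp pM x c1) f2i.
  apply: eq_integrable => //= y _; rewrite mulrC; congr (_ * _)%:E.
  by apply: eq_Rintegral => x _; rewrite !psym /poisson -sqrrN opprB.
- exact (integrableZl measurableT pi f2i).
move=> y _; rewrite mulrC ler_wpM2r ?sqr_ge0//.
under eq_Rintegral do rewrite mulr1 psym.
exact: Rintegral_poisson_le.
Qed.

Lemma Rintegral_normr_sqr_le :
  (\int[m1]_y `|f y|) ^+ 2 <= (b - a) * \int[m1]_y (f y ^+ 2).
Proof.
have fni : m1.-integrable setT (EFin \o (fun y => `|f y|)) by exact: integrable_norm fi.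
have fn2i : m1.-integrable setT (EFin \o (fun y => `|f y| ^+ 2)).
  by apply: eq_integrable f2i => //= y _; rewrite real_normK ?num_real.
have e1 : \int[m1]_y `|f y| = \int[m1]_y (1 * `|f y|).
  by apply: eq_Rintegral => y _; rewrite mul1r.
have e2 : \int[m1]_y (f y ^+ 2) = \int[m1]_y (1 * `|f y| ^+ 2).
  by apply: eq_Rintegral => y _; rewrite mul1r real_normK ?num_real.
rewrite e1 e2; apply: (@weighted_Jensen _ _ _ _ _ _ 1) => //.
  by rewrite subr_gt0.
have fT : fleb_on a b setT = @lebesgue_measure R `]a, b[%classic.
  by change (@lebesgue_measure R (setT `&` `]a, b[%classic) = @lebesgue_measure R `]a,
      b[%classic); rewrite setTI.
rewrite Rintegral_cst// mul1r [X in fine X]fT.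
by rewrite lebesgue_measure_itv/= lte_fin ab.
Qed.

Lemma normr_kint_cut_inv_le x :
  `|kint m1 k f x| <= `|kint m1 q f x| + kint m1 p (fun y => `|f y|) x.
Proof.
have fni : m1.-integrable setT (EFin \o (fun y => `|f y|)) by exact: integrable_norm fi.
have ik := integrable_kernel mk kM x fi.
have iq := integrable_kernel mq qM x fi.
have ip := integrable_kernel mp pM x fni.
have ikq := integrableB measurableT ik iq.
have -> : kint m1 k f x = kint m1 q f x + (kint m1 k f x - kint m1 q f x) by rewrite addrC
    subrK.
apply: (le_trans (ler_normD _ _)); rewrite lerD2l.
rewrite /kint -(RintegralB measurableT ik iq).
apply: (le_trans (le_normr_Rintegral measurableT ikq)).
apply: le_Rintegral => //; first exact (integrable_norm ikq).
move=> y _; rewrite -mulrBl normrM ler_wpM2r//.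
exact: cut_inv_sub_conj_poisson.
Qed.

End truncated_kernels.

(** Here q and p are the squared norms of the conjugate Poisson and Poisson images of f, p' that of
    the Poisson image of |f|, s and n the squared L^2 and L^1 norms of f, D = d - c, W = b - a and k
    = pi^2. The factors 2 in the conclusion come from (x + y)^2 <= 2 x^2 + 2 y^2. *)
Lemma combine_bounds (R : realType) (q p p' s n D W k : R) :
  0 <= D -> q <= p + 2 * D * n -> p <= k * s -> p' <= k * s -> n <= W * s ->
  2 * q + 2 * p' <= (4 * k + 4 * D * W) * s.
Proof.
move=> D0 qp ps ps' nW.
have : 2 * D * n <= 2 * D * (W * s) by rewrite ler_wpM2l// mulr_ge0.
lra.
Qed.

Section truncated_hilbert.
Variable R : realType.
Variables (a b c d e : R) (f : R -> R).
Hypotheses (ab : a < b) (ca : c <= a - 1) (bd : b + 1 <= d) (e0 : 0 < e).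
Local Notation m1 := (fleb_on a b).
Local Notation m2 := (fleb_on c d).

Lemma Rintegral_cut_inv_sqr_le :
  m1.-integrable setT (EFin \o f) ->
  m1.-integrable setT (EFin \o (fun x => f x ^+ 2)) ->
  \int[m2]_x (kint m1 (conv_kernel (cut_inv e)) f x ^+ 2) <=
  (4 * pi ^+ 2 + 4 * (d - c) * (b - a)) * \int[m1]_y (f y ^+ 2).
Proof.
move=> fi f2i.
have cd : 0 <= d - c by move: ab ca bd => *; lra.
have fni : m1.-integrable setT (EFin \o (fun y => `|f y|)) by exact: integrable_norm fi.
have fn2i : m1.-integrable setT (EFin \o (fun y => `|f y| ^+ 2)).
  by apply: eq_integrable f2i => //= y _; rewrite real_normK ?num_real.
have e2 : \int[m1]_y (`|f y| ^+ 2) = \int[m1]_y (f y ^+ 2).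
  by apply: eq_Rintegral => y _; rewrite real_normK ?num_real.
have mq : measurable_fun setT (conv_kernel (@conj_poisson R e)).
  by apply: measurable_conv_kernel; apply: continuous_measurable_fun;
      exact: continuous_conj_poisson.
have mp : measurable_fun setT (conv_kernel (@poisson R e)).
  by apply: measurable_conv_kernel; apply: continuous_measurable_fun; exact: continuous_poisson.
have mk : measurable_fun setT (conv_kernel (@cut_inv R e)).
  by apply: measurable_conv_kernel; exact: measurable_cut_inv.
have qM z : `|conv_kernel (@conj_poisson R e) z| <= e^-1 by exact: normr_conj_poisson.
have pM z : `|conv_kernel (@poisson R e) z| <= e^-1 by exact: normr_poisson.
have kM z : `|conv_kernel (@cut_inv R e) z| <= e^-1 by exact: normr_cut_inv.
have ik2 := integrable_kint_sqr m2 mk kM fi.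
have iq2 := integrable_kint_sqr m2 mq qM fi.
have ip2 := integrable_kint_sqr m2 mp pM fni.
have iq2' := integrableZl measurableT 2 iq2.
have ip2' := integrableZl measurableT 2 ip2.
have iqp := integrableD measurableT iq2' ip2'.
have pw x : kint m1 (conv_kernel (@cut_inv R e)) f x ^+ 2 <=
    2 * kint m1 (conv_kernel (@conj_poisson R e)) f x ^+ 2 +
    2 * kint m1 (conv_kernel (@poisson R e)) (fun y => `|f y|) x ^+ 2.
  have := normr_kint_cut_inv_le e0 fi x.
  set A := kint m1 (conv_kernel (@cut_inv R e)) f x.
  set B := kint m1 (conv_kernel (@conj_poisson R e)) f x.
  set C := kint m1 (conv_kernel (@poisson R e)) (fun y => `|f y|) x => ABC.
  rewrite -(real_normK (num_real A)) -(real_normK (num_real B)).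
  have := sqr_ge0 (`|B| - C); have := normr_ge0 A; nra.
apply: (le_trans (le_Rintegral measurableT ik2 iqp (fun x _ => pw x))).
rewrite RintegralD// !RintegralZl//.
have h1 := Rintegral_conj_poisson_sqr_le ca bd e0 fi.
have h2 := Rintegral_poisson_sqr_le ab ca bd e0 fi f2i.
have h3 := Rintegral_poisson_sqr_le ab ca bd e0 fni fn2i.
rewrite e2 in h3.
have h4 := Rintegral_normr_sqr_le ab fi f2i.
exact: combine_bounds cd h1 h2 h3 h4.
Qed.

End truncated_hilbert.

(** * The inner product of L^2 *)

Section L2_theory.
Variables (R : realType) (a b : R).
Local Notation mu := (leb_on a b).
Implicit Types f g h : R -> R.

Lemma L2_measurable f : L2 a b f -> measurable_fun setT f.
Proof. by move=> /andP[]; rewrite inE. Qed.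

Lemma L2_integrableM f g : L2 a b f -> L2 a b g ->
  mu.-integrable setT (EFin \o (fun x => f x * g x)).
Proof. by move=> Lf Lg; apply/Lfun1_integrable; exact: Lfun2_mul_Lfun1. Qed.

Lemma L2_cst (c : R) : L2 a b (fun=> c).
Proof.
have h : leb_on a b setT \is a fin_num by rewrite ge0_fin_numE ?leb_on_setT.
rewrite /L2 /= leb_onE; exact: (Lfun_cst _ c 2).
Qed.

Lemma L2_integrable f : L2 a b f -> mu.-integrable setT (EFin \o f).
Proof.
move=> Lf; apply: eq_integrable (L2_integrableM Lf (L2_cst 1)) => //= x _.
by rewrite mulr1.
Qed.

Lemma L2_integrable_sqr f : L2 a b f ->
  mu.-integrable setT (EFin \o (fun x => f x ^+ 2)).
Proof. by move=> Lf; apply: eq_integrable (L2_integrableM Lf Lf) => //= x _. Qed.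

Lemma L2_le f g : measurable_fun setT f -> L2 a b g ->
  (forall x, `|f x| <= `|g x|) -> L2 a b f.
Proof.
move=> mf Lg fg.
have [_ g2] := integrableP _ _ _ (L2_integrable_sqr Lg).
apply/andP; split; rewrite inE//= /finite_norm unlock.
apply: poweR_lty; apply: le_lt_trans g2.
apply: ge0_le_integral => //=.
- apply/measurable_EFinP; apply: (measurableT_comp (measurable_powR _)).
  exact: measurableT_comp.
- apply/measurable_EFinP; apply: measurableT_comp => //.
  by apply/measurable_funX; exact: L2_measurable Lg.
- move=> x _; rewrite lee_fin powR_mulrn// normrX.
  by rewrite ler_pXn2r// ?nnegrE.
Qed.

Lemma L2D f g : L2 a b f -> L2 a b g -> L2 a b (fun x => f x + g x).
Proof.
move=> Lf Lg.
by have [_] := @Lfun_addr_closed _ _ R mu 2%:E ltac:(by rewrite lee_fin ler1n); apply.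
Qed.

Lemma L2Z (c : R) f : L2 a b f -> L2 a b (fun x => c * f x).
Proof.
move=> Lf; have -> : (fun x => c * f x) = c \o* f.
  by apply/funext => x; rewrite /= mulrC.
by apply: Lfun_scale => //; rewrite ler1n.
Qed.

Lemma L2B f g : L2 a b f -> L2 a b g -> L2 a b (fun x => f x - g x).
Proof.
move=> Lf Lg.
have -> : (fun x => f x - g x) = (fun x => f x + -1 * g x).
  by apply/funext => x; rewrite mulN1r.
exact: L2D Lf (L2Z _ Lg).
Qed.

Lemma L2_sum (I : Type) (s : seq I) (c : I -> R) (e : I -> R -> R) :
  (forall n, L2 a b (e n)) -> L2 a b (fun x => \sum_(n <- s) c n * e n x).
Proof.
move=> Le; elim: s => [|n s IH].
  have -> : (fun x => \sum_(n <- [::]) c n * e n x) = (fun=> 0 : R).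
    by apply/funext => x; rewrite big_nil.
  exact: L2_cst.
have -> : (fun x => \sum_(n <- n :: s) c n * e n x) =
    (fun x => c n * e n x + \sum_(n <- s) c n * e n x).
  by apply/funext => x; rewrite big_cons.
exact: L2D (L2Z _ (Le n)) IH.
Qed.

Local Notation ip := (ipL2 a b).

Lemma ipC f g : ip f g = ip g f.
Proof. by apply: eq_Rintegral => x _; rewrite mulrC. Qed.

Lemma ipDl f g h : L2 a b f -> L2 a b g -> L2 a b h ->
  ip (fun x => f x + g x) h = ip f h + ip g h.
Proof.
move=> Lf Lg Lh; rewrite -RintegralD//; [|exact: L2_integrableM..].
by apply: eq_Rintegral => x _; rewrite mulrDl.
Qed.

Lemma ipZl (c : R) f h : L2 a b f -> L2 a b h ->
  ip (fun x => c * f x) h = c * ip f h.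
Proof.
move=> Lf Lh; rewrite -RintegralZl//; last exact: L2_integrableM.
by apply: eq_Rintegral => x _; rewrite mulrA.
Qed.

Lemma ipBl f g h : L2 a b f -> L2 a b g -> L2 a b h ->
  ip (fun x => f x - g x) h = ip f h - ip g h.
Proof.
move=> Lf Lg Lh; rewrite -RintegralB//; [|exact: L2_integrableM..].
by apply: eq_Rintegral => x _; rewrite mulrBl.
Qed.

Lemma ip_suml (I : Type) (s : seq I) (c : I -> R) (e : I -> R -> R) h :
  (forall n, L2 a b (e n)) -> L2 a b h ->
  ip (fun x => \sum_(n <- s) c n * e n x) h = \sum_(n <- s) c n * ip (e n) h.
Proof.
move=> Le Lh; elim: s => [|n s IH].
  rewrite big_nil /ipL2; under eq_Rintegral do rewrite big_nil mul0r.
  by rewrite Rintegral_cst// mul0r.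
rewrite big_cons -IH -ipZl// -ipDl//; [|exact: L2Z|exact: L2_sum].
by apply: eq_Rintegral => x _; rewrite big_cons.
Qed.

Lemma ip_ge0 f : 0 <= ip f f.
Proof. by apply: Rintegral_ge0 => x _; rewrite -expr2 sqr_ge0. Qed.

Lemma normL2E f : L2 a b f -> normL2 a b f = (Num.sqrt (ip f f))%:E.
Proof.
move=> Lf; rewrite /normL2 unlock.
have -> : (\int[mu]_x `|(EFin \o f) x| `^ 2 = \int[mu]_x ((f x * f x)%:E))%E.
  apply: eq_integral => x _ /=.
  by rewrite powR_mulrn// real_normK ?num_real.
rewrite -[X in (X `^ _)%E]fineK; last exact: integrable_fin_num (L2_integrableM Lf Lf).
by rewrite poweR_EFin powR12_sqrt// ip_ge0.
Qed.

Lemma normL2_leP f (c : R) : 0 <= c -> L2 a b f ->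
  (normL2 a b f <= c%:E)%E = (ip f f <= c ^+ 2).
Proof.
move=> c0 Lf; rewrite normL2E// lee_fin.
by rewrite -{1}(ger0_norm c0) -sqrtr_sqr ler_sqrt// sqr_ge0.
Qed.

Lemma normL2D f g : L2 a b f -> L2 a b g ->
  (normL2 a b (fun x => f x + g x)%R <= normL2 a b f + normL2 a b g)%E.
Proof.
move=> Lf Lg; have mf := L2_measurable Lf; have mg := L2_measurable Lg.
have := @eminkowski _ _ R mu f g 2%:E mf mg ltac:(by rewrite lee_fin ler1n).
exact.
Qed.

Lemma normL2Z (c : R) f : L2 a b f ->
  (normL2 a b (fun x => c * f x)%R = `|c|%:E * normL2 a b f)%E.
Proof.
move=> Lf; rewrite !normL2E//; last exact: L2Z.
rewrite -EFinM ipZl//; last exact: L2Z.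
by rewrite ipC ipZl// mulrA -expr2 sqrtrM ?sqr_ge0// sqrtr_sqr.
Qed.

End L2_theory.

(** * Finite orthonormal expansions *)

Section orthonormal.
Variables (R : realType) (a b : R) (e : int -> R -> R).
Hypothesis Le : forall n, L2 a b (e n).
Hypothesis oe : forall m n, ipL2 a b (e m) (e n) = (m == n)%:R.
Local Notation ip := (ipL2 a b).

Definition lincomb (s : seq int) (c : int -> R) : R -> R :=
  fun x => \sum_(n <- s) c n * e n x.

Lemma L2_lincomb s c : L2 a b (lincomb s c).
Proof. exact: L2_sum. Qed.

Lemma ip_lincombl s c f : L2 a b f -> ip (lincomb s c) f = \sum_(n <- s) c n * ip f (e n).
Proof. by move=> Lf; rewrite ip_suml//; apply: eq_bigr => n _; rewrite ipC. Qed.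

Lemma ip_lincomb_basis s c m : uniq s ->
  ip (lincomb s c) (e m) = if m \in s then c m else 0.
Proof.
move=> us; rewrite ip_lincombl//.
case: ifPn => ms.
  rewrite (bigD1_seq m)//= oe eqxx mulr1 big1 ?addr0// => n nm.
  by rewrite oe eq_sym (negbTE nm) mulr0.
rewrite big_seq big1// => n ns; rewrite oe.
have /negbTE -> : m != n by apply: contraNneq ms => ->.
by rewrite mulr0.
Qed.

Lemma ip_lincomb_sqr s c : uniq s -> ip (lincomb s c) (lincomb s c) = \sum_(n <- s) c n ^+ 2.
Proof.
move=> us; rewrite ip_lincombl; last exact: L2_lincomb.
by rewrite big_seq [RHS]big_seq; apply: eq_bigr => n ns; rewrite ip_lincomb_basis// ns.
Qed.

Lemma ip_sub_lincomb s c f : uniq s -> L2 a b f ->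
  ip (fun x => f x - lincomb s c x) (fun x => f x - lincomb s c x) =
  ip f f - 2 * \sum_(n <- s) c n * ip f (e n) + \sum_(n <- s) c n ^+ 2.
Proof.
move=> us Lf; have LS := L2_lincomb s c; have LB := L2B Lf LS.
rewrite ipBl// ![ip _ (fun x => _ - _)]ipC !ipBl// ip_lincomb_sqr// [ip f (lincomb _ _)]ipC.
by rewrite ip_lincombl//; ring.
Qed.

Lemma Bessel s f : uniq s -> L2 a b f -> \sum_(n <- s) ip f (e n) ^+ 2 <= ip f f.
Proof.
move=> us Lf; have := ip_ge0 a b (fun x => f x - lincomb s (fun n => ip f (e n)) x).
rewrite ip_sub_lincomb//; under eq_bigr do rewrite -expr2; lra.
Qed.

(** Totality provides a list that may repeat indices; equal terms are merged by multiplying the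
    coefficient by the multiplicity. *)
Lemma lincomb_undup s c : exists c', lincomb s c = lincomb (undup s) c'.
Proof.
exists (fun n => c n *+ count_mem n s); apply/funext => x.
rewrite /lincomb -[LHS]big_undup_iterop_count; apply: eq_bigr => n _.
by rewrite mulrnAl.
Qed.

(** By [ip_sub_lincomb] the two sides differ by the sum of the squares of c n - <f, e n>. *)
Lemma best_approximation s c f : uniq s -> L2 a b f ->
  let r := fun x => f x - lincomb s (fun n => ip f (e n)) x in
  let r' := fun x => f x - lincomb s c x in
  ip r r <= ip r' r'.
Proof.
move=> us Lf /=; rewrite !ip_sub_lincomb//.
rewrite (eq_bigr (fun n => ip f (e n) ^+ 2)); last by move=> n _; rewrite expr2.
have : 0 <= \sum_(n <- s) (c n ^+ 2 - 2 * (c n * ip f (e n)) + ip f (e n) ^+ 2).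
  apply: sumr_ge0 => n _.
  have -> : c n ^+ 2 - 2 * (c n * ip f (e n)) + ip f (e n) ^+ 2 = (c n - ip f (e n)) ^+ 2
      by ring.
  exact: sqr_ge0.
rewrite big_split /= big_split /= sumrN -mulr_sumr; lra.
Qed.

Lemma normr_ip_basis f n : L2 a b f -> `|ip f (e n)| <= Num.sqrt (ip f f).
Proof.
move=> Lf; rewrite -sqrtr_sqr ler_wsqrtr//.
by have := @Bessel [:: n] f isT Lf; rewrite big_seq1.
Qed.

End orthonormal.

(** The gain over totality is that the coefficients are those of [f] itself, so that only the index
    list depends on [eps]. *)
Lemma onb_approximation (R : realType) (a b : R) (e : int -> R -> R) f (eps : R) :
  orthonormal_basis a b e -> L2 a b f -> 0 < eps ->
  exists2 s, uniq s &
    (normL2 a b (fun x => (f x - lincomb e s (fun n => ipL2 a b f (e n)) x)%R) <= eps%:E)%E.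
Proof.
case=> Le oe te Lf eps0; have [s [c /ltW]] := te _ Lf _ eps0.
have [c' ec'] := lincomb_undup e s c.
rewrite -[fun x => (_ - _)%R]/(fun x => (f x - lincomb e s c x)%R) ec' => h.
exists (undup s); first exact: undup_uniq.
move: h; rewrite !normL2_leP ?(ltW eps0)//; [|by apply: L2B => //; exact: L2_lincomb..].
by apply: le_trans; exact: best_approximation (undup_uniq s) Lf.
Qed.

(** * Principal values *)

Lemma limn_einf_le (R : realType) (u : (\bar R)^nat) (M : \bar R) :
  (forall n, (u n <= M)%E) -> (limn_einf u <= M)%E.
Proof.
move=> uM; rewrite limn_einf_lim; apply: lime_le; first exact: is_cvg_einfs.
apply: nearW => n; apply: le_trans (uM n).
by apply: ereal_inf_lbound; exists n => //=.
Qed.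

Lemma fatou_sqr d (T : measurableType d) (R : realType)
    (mu : {measure set T -> \bar R}) (F : nat -> T -> R) (h : T -> R) (M : R) :
  (forall n, measurable_fun setT (F n)) -> measurable_fun setT h ->
  {ae mu, forall x, F n x @[n --> \oo] --> h x} ->
  (forall n, (\int[mu]_x (F n x ^+ 2)%:E <= M%:E)%E) ->
  (\int[mu]_x (h x ^+ 2)%:E <= M%:E)%E.
Proof.
move=> mF mh Fh FM.
pose u n x := (F n x ^+ 2)%:E.
have mu_ n : measurable_fun setT (u n) by apply/measurable_EFinP; exact: measurable_funX.
have u0 n x : setT x -> (0 <= u n x)%E by move=> _; rewrite lee_fin sqr_ge0.
apply: (@le_trans _ _ (\int[mu]_x limn_einf (u ^~ x))%E).
  apply: ae_ge0_le_integral => //.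
  - by move=> x _; rewrite lee_fin sqr_ge0.
  - by apply/measurable_EFinP; exact: measurable_funX.
  - move=> x _; rewrite limn_einf_lim; apply: lime_ge; first exact: is_cvg_einfs.
    apply: nearW => n; apply: le_ereal_inf_tmp => _ [m _ <-]; exact: u0.
  - rewrite (_ : (fun x => _) = (fun x => - limn_esup (fun n => - u n x))%E).
      apply: measurableT_comp => //; apply: measurable_fun_limn_esup => n.
      exact: measurableT_comp.
    apply/funext => x.
    by rewrite -[X in limn_esup X]/(-%E \o (u ^~ x)) limn_esupN oppeK.
  apply: filterS Fh => x Fhx _.
  have /cvg_limn_einf_sup[-> _] // : u n x @[n --> \oo] --> (h x ^+ 2)%:E.
  apply: cvg_EFin; first exact: nearW.
  by rewrite /u /comp /=; under eq_fun do rewrite expr2; rewrite expr2; exact: cvgM.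
apply: (le_trans (fatou mu measurableT mu_ u0)).
exact: limn_einf_le.
Qed.

Section truncated_HT.
Variables (R : realType) (a b : R).
Implicit Types (f h : R -> R) (x e : R).
Local Notation T e f x := (kint (fleb_on a b) (conv_kernel (cut_inv e)) f x).

(** The strict inequality in [cut_inv] matches the open ball, so the integral in the principal value
    is exactly an operator with bounded kernel. *)
Lemma Rintegral_off_ball f x e : 0 < e -> L2 a b f ->
  \int[@lebesgue_measure R]_(y in `]a, b[%classic `\` ball x e) (f y / (y - x)) = T e f x.
Proof.
move=> e0 Lf; rewrite /kint /Rintegral.
have mk : measurable_fun setT (fun y : measurableTypeR R => conv_kernel (@cut_inv R e) (x,
    y) * f y).
  apply: measurable_funM; last exact: L2_measurable Lf.
  exact: measurable_fun_pair2 (measurable_conv_kernel (measurable_cut_inv e0)).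
rewrite [in RHS](@integral_leb_on _ a b _ ((measurable_EFinP _ _).2 mk)).
rewrite setDE integral_mkcondr; congr fine; apply: eq_integral => y _.
have yE : (y \in ~` ball x e) = ~~ (`|y - x| < e).
  by rewrite in_setC; congr (~~ _); apply/idP/idP; rewrite inE /ball/= distrC.
rewrite /patch yE /conv_kernel /cut_inv/=.
by case: ltP => _ /=; rewrite ?mul0r// mulrC.
Qed.

Lemma is_pv_truncated f x l : L2 a b f ->
  is_pv `]a, b[%classic (fun y => f y / (y - x)) x l <-> T e f x @[e --> 0^'+] --> l.
Proof.
move=> Lf; rewrite /is_pv.
split; apply: cvg_trans; apply: near_eq_cvg.
  by near=> e; rewrite -Rintegral_off_ball.
by near=> e; rewrite Rintegral_off_ball.
Unshelve. all: by end_near. Qed.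

End truncated_HT.

(** * Linearity and boundedness of the truncated Hilbert transform *)

Section is_HT.
Variables (R : realType) (a1 a2 a3 a4 : R).
Implicit Types (f g h k : R -> R) (x e : R).
Local Notation T e f x := (kint (fleb_on a2 a4) (conv_kernel (cut_inv e)) f x).
Local Notation HT := (is_HT a1 a2 a3 a4).

Lemma kint_cut_inv_axpy (c : R) f g x e : 0 < e -> L2 a2 a4 f -> L2 a2 a4 g ->
  T e (fun y => c * f y + g y) x = c * T e f x + T e g x.
Proof.
move=> e0 Lf Lg.
have mk : measurable_fun setT (conv_kernel (@cut_inv R e)).
  by apply: measurable_conv_kernel; exact: measurable_cut_inv.
have kM z : `|conv_kernel (@cut_inv R e) z| <= e^-1 by exact: normr_cut_inv.
have i1 := @integrable_kernel _ _ _ _ _ (fleb_on a2 a4) _ _ mk kM f x (L2_integrable Lf).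
have i2 := @integrable_kernel _ _ _ _ _ (fleb_on a2 a4) _ _ mk kM g x (L2_integrable Lg).
rewrite /kint -(RintegralZl c measurableT i1).
rewrite -(RintegralD measurableT (integrableZl measurableT c i1) i2).
by apply: eq_Rintegral => y _; ring.
Qed.

Lemma is_HT_axpy (c : R) f g h k : L2 a2 a4 f -> L2 a2 a4 g -> HT f h -> HT g k ->
  HT (fun x => c * f x + g x) (fun x => c * h x + k x).
Proof.
move=> Lf Lg [Lh fh] [Lk gk]; split; first exact: L2D (L2Z _ Lh) Lk.
apply: (@filterS2 _ _ (ae_filter_ringOfSetsType (leb_on a1 a3)) _ _ _ _ fh gk) => x [l fl
    ->] [m gm ->].
exists (c * l + m); last by rewrite mulrDr; ring.
apply/is_pv_truncated; first exact: L2D (L2Z _ Lf) Lg.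
move/(is_pv_truncated _ _ Lf) in fl; move/(is_pv_truncated _ _ Lg) in gm.
have cv : (c * T e f x + T e g x) @[e --> 0^'+] --> c * l + m.
  by apply: cvgD gm; apply: cvgM fl; exact: cvg_cst.
apply: cvg_trans cv; apply: near_eq_cvg; near=> e.
by rewrite kint_cut_inv_axpy.
Unshelve. all: by end_near. Qed.

Lemma is_HT0 : HT (fun=> 0) (fun=> 0).
Proof.
split; first exact: L2_cst.
apply: ae_leb_on => x _; exists 0; last by rewrite mulr0.
apply/is_pv_truncated; first exact: L2_cst.
have -> : (fun e => T e (fun=> 0) x) = (fun=> 0).
  apply/funext => e; rewrite /kint; under eq_Rintegral do rewrite mulr0.
  by rewrite Rintegral_cst// mul0r.
exact: cvg_cst.
Qed.

Lemma is_HT_sum (I : Type) (s : seq I) (c : I -> R) (u w : I -> R -> R) :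
  (forall n, L2 a2 a4 (u n)) -> (forall n, HT (u n) (w n)) ->
  HT (fun x => \sum_(n <- s) c n * u n x) (fun x => \sum_(n <- s) c n * w n x).
Proof.
move=> Lu uw; elim: s => [|n s IH].
  rewrite [X in HT X _](_ : _ = fun=> 0); last by apply/funext => x; rewrite big_nil.
  rewrite [X in HT _ X](_ : _ = fun=> 0); last by apply/funext => x; rewrite big_nil.
  exact: is_HT0.
rewrite [X in HT X _](_ : _ = fun x => c n * u n x + \sum_(n <- s) c n * u n x); last first.
  by apply/funext => x; rewrite big_cons.
rewrite [X in HT _ X](_ : _ = fun x => c n * w n x + \sum_(n <- s) c n * w n x); last first.
  by apply/funext => x; rewrite big_cons.
by apply: is_HT_axpy => //; exact: L2_sum.
Qed.

Lemma is_HTB f g h k : L2 a2 a4 f -> L2 a2 a4 g -> HT f h -> HT g k ->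
  HT (fun x => f x - g x) (fun x => h x - k x).
Proof.
move=> Lf Lg fh gk; have := is_HT_axpy (-1) Lg Lf gk fh.
by congr HT; apply/funext => x; ring.
Qed.

Lemma is_HT_bounded : a2 < a4 ->
  exists2 C : R, 0 <= C &
  forall f h, L2 a2 a4 f -> HT f h -> ipL2 a1 a3 h h <= C * ipL2 a2 a4 f f.
Proof.
move=> a24.
(* The enlarged output interval: it contains []a1, a3[] and leaves margin 1 around []a2, a4[], as
   the logarithmic bounds require. *)
pose c := Num.min a1 (a2 - 1); pose d := Num.max a3 (a4 + 1).
have ca1 : c <= a1 by rewrite ge_min lexx.
have ca2 : c <= a2 - 1 by rewrite ge_min lexx orbT.
have da3 : a3 <= d by rewrite le_max lexx.
have da4 : a4 + 1 <= d by rewrite le_max lexx orbT.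
pose B := 4 * pi ^+ 2 + 4 * (d - c) * (a4 - a2).
have B0 : 0 <= B.
  by rewrite addr_ge0// !mulr_ge0 ?sqr_ge0 ?ler0n ?pi_ge0//; lra.
exists (pi^-1 ^+ 2 * B) => [|f h Lf [Lh fh]]; first by rewrite mulr_ge0 ?sqr_ge0.
have fi : (fleb_on a2 a4).-integrable setT (EFin \o f) := L2_integrable Lf.
have f2i : (fleb_on a2 a4).-integrable setT (EFin \o (fun x => f x ^+ 2)) :=
  L2_integrable_sqr Lf.
(* Fatou's lemma works along a sequence; the cut-offs 1/(n + 1) tend to 0 from the right. *)
pose F (n : nat) x := pi^-1 * T (harmonic n) f x.
have h0 n : 0 < harmonic n :> R by exact: harmonic_gt0.
have mk n : measurable_fun setT (conv_kernel (@cut_inv R (harmonic n))).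
  by apply: measurable_conv_kernel; exact: measurable_cut_inv.
have kM n z : `|conv_kernel (@cut_inv R (harmonic n)) z| <= (harmonic n)^-1.
  exact: normr_cut_inv.
have mF n : measurable_fun setT (F n).
  by apply: measurable_funM => //; exact: (measurable_kint (fleb_on c d) (mk n) (kM n) fi).
have ikc n := integrable_kint_sqr (fleb_on c d) (mk n) (kM n) fi.
have hE : (\int[leb_on a1 a3]_x (h x ^+ 2)%:E = (ipL2 a1 a3 h h)%:E)%E.
  by rewrite -[LHS]fineK ?integrable_fin_num//; exact: L2_integrable_sqr.
rewrite -lee_fin -hE; apply: (@fatou_sqr _ (measurableTypeR R) R (leb_on a1 a3) F h) => //.
- exact: L2_measurable Lh.
- apply: (@filterS _ _ (ae_filter_ringOfSetsType (leb_on a1 a3)) _ _ _ fh) => x [l fl ->].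
  apply: cvgM; first exact: cvg_cst.
  move/(is_pv_truncated _ _ Lf)/cvg_at_rightP : fl; apply.
  by split => //; exact: cvg_harmonic.
- move=> n.
  have mF2 : measurable_fun setT (fun x => (F n x ^+ 2)%:E).
    by apply/measurable_EFinP; exact: measurable_funX.
  rewrite integral_leb_on//.
  apply: (@le_trans _ _ (\int[leb_on c d]_x (F n x ^+ 2)%:E)%E).
    rewrite integral_leb_on//; apply: ge0_subset_integral => //.
    - exact: measurable_funTS.
    - by move=> x _; rewrite lee_fin sqr_ge0.
    - by apply: subset_itvW.
  have -> : (\int[leb_on c d]_x (F n x ^+ 2)%:E)%E = (pi^-1 ^+ 2 * \int[fleb_on c d]_x (T
      (harmonic n) f x ^+ 2))%:E.
    rewrite -(RintegralZl _ measurableT (ikc n)) /Rintegral fineK; last first.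
      exact: integrable_fin_num (integrableZl measurableT _ (ikc n)).
    by apply: eq_integral => x _; rewrite exprMn.
  rewrite lee_fin -[leRHS]mulrA ler_wpM2l ?sqr_ge0//.
  exact: (Rintegral_cut_inv_sqr_le a24 ca2 da4 (h0 n) fi f2i).
Qed.

End is_HT.

(** * Coefficients in the singular system *)

Section singular.
Variables (R : realType) (a1 a2 a3 a4 : R) (u v : int -> R -> R) (sigma : int -> R).
Hypotheses (a24 : a2 < a4) (onbu : orthonormal_basis a2 a4 u)
  (onbv : orthonormal_basis a1 a3 v)
  (uv : forall n, is_HT a1 a2 a3 a4 (u n) (fun x => sigma n * v n x)).

(** For finite combinations of the [u m] this is orthonormality. If such a combination is within eps
    of [f], the two sides differ by at most (sqrt C + |sigma n|) eps, where C comes from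
    boundedness. *)
Lemma HT_coef f h n : L2 a2 a4 f -> is_HT a1 a2 a3 a4 f h ->
  ipL2 a1 a3 h (v n) = sigma n * ipL2 a2 a4 f (u n).
Proof.
move=> Lf fh; have [C C0 HC] := is_HT_bounded a1 a3 a24.
have [Lu ou _] := onbu; have [Lv ov _] := onbv.
(* The summand 1 makes [D] positive, so that an arbitrary error can be divided by it. *)
set D := Num.sqrt C + `|sigma n| + 1.
have D0 : 0 < D by rewrite ltr_wpDl// addr_ge0// sqrtr_ge0.
suff K eps : 0 < eps -> `|ipL2 a1 a3 h (v n) - sigma n * ipL2 a2 a4 f (u n)| <= D * eps.
  apply/eqP; rewrite -subr_eq0 -normr_eq0 eq_le normr_ge0 andbT.
  apply/ler_addgt0Pr => e e0; rewrite add0r.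
  by have := K (e / D) (divr_gt0 e0 D0); rewrite mulrCA divff ?gt_eqF// mulr1.
move=> eps0; have [s us fs] := onb_approximation onbu Lf eps0.
set c := fun n => ipL2 a2 a4 f (u n) in fs *.
set S := lincomb u s c in fs *.
pose W x := \sum_(m <- s) c m * (sigma m * v m x).
have LS : L2 a2 a4 S by exact: L2_lincomb.
have LW : L2 a1 a3 W by apply: L2_sum => m; exact: L2Z.
have rW : is_HT a1 a2 a3 a4 (fun x => f x - S x) (fun x => h x - W x).
  by apply: is_HTB => //; exact: is_HT_sum.
have Lr := L2B Lf LS.
have Lh : L2 a1 a3 h by case: fh.
have LhW := L2B Lh LW.
have WS : ipL2 a1 a3 W (v n) = sigma n * ipL2 a2 a4 S (u n).
  rewrite /W /S /lincomb !ip_suml//; last by move=> m; exact: L2Z.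
  rewrite mulr_sumr; apply: eq_bigr => m _.
  rewrite ipZl// ov ou; have [->|_] := eqVneq m n; rewrite ?mulr0// !mulr1.
  by rewrite mulrC.
have -> : ipL2 a1 a3 h (v n) - sigma n * ipL2 a2 a4 f (u n) =
    ipL2 a1 a3 (fun x => h x - W x) (v n) - sigma n * ipL2 a2 a4 (fun x => f x - S x) (u n).
  by rewrite !ipBl// WS; ring.
apply: (le_trans (ler_normB _ _)); rewrite normrM.
move: fs; rewrite normL2_leP ?(ltW eps0)// => fs.
have b1 : Num.sqrt (ipL2 a2 a4 (fun x => f x - S x) (fun x => f x - S x)) <= eps.
  by rewrite -[leRHS](gtr0_norm eps0) -sqrtr_sqr ler_wsqrtr.
have b2 : Num.sqrt (ipL2 a1 a3 (fun x => h x - W x) (fun x => h x - W x)) <= Num.sqrt C * eps.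
  rewrite -[X in _ * X](gtr0_norm eps0) -sqrtr_sqr -sqrtrM// ler_wsqrtr//.
  by apply: (le_trans (HC _ _ Lr rW)); rewrite ler_wpM2l.
have b3 := le_trans (normr_ip_basis Lv ov n LhW) b2.
have b4 := le_trans (normr_ip_basis Lu ou n Lr) b1.
rewrite /D mulrDl mul1r mulrDl.
apply: (@le_trans _ _ (Num.sqrt C * eps + `|sigma n| * eps)); last by rewrite lerDl ltW.
by apply: lerD => //; rewrite ler_wpM2l.
Qed.

End singular.

(** * Geometric sums over finite sets of integers *)

Lemma absz_subr_inj (c m n : int) : c <= m -> c <= n -> `|m - c|%N = `|n - c|%N -> m = n.
Proof. lia. Qed.

Lemma absz_subl_inj (c m n : int) : m <= c -> n <= c -> `|c - m|%N = `|c - n|%N -> m = n.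
Proof. lia. Qed.

Section geometric_sums.
Variable R : realType.

(** Up to order, a duplicate-free list is a part of the initial segment below [N], and the added
    terms are nonnegative. *)
Lemma sum_geometric_uniq (q : R) (t : seq nat) : 0 <= q -> q < 1 -> uniq t ->
  \sum_(k <- t) q ^+ k <= (1 - q)^-1.
Proof.
move=> q0 q1 ut; pose N := (\max_(k <- t) k).+1.
have tP : perm_eq t [seq k <- iota 0 N | k \in t].
  apply: uniq_perm => //; first by rewrite filter_uniq// iota_uniq.
  move=> k; rewrite mem_filter mem_iota /= add0n.
  case kt : (k \in t) => //=; rewrite ltnS.
  by apply/esym; apply: (@leq_bigmax_seq _ t xpredT id).
rewrite (perm_big _ tP) big_filter.
apply: (@le_trans _ _ (\sum_(k <- iota 0 N) q ^+ k)).
  rewrite big_mkcond; apply: ler_sum => k _; case: ifP => // _; exact: exprn_ge0.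
have -> : \sum_(k <- iota 0 N) q ^+ k = \sum_(k < N) q ^+ k.
  by rewrite -(big_mkord xpredT (fun k => q ^+ k)) /index_iota subn0.
have q1' : 0 < 1 - q by rewrite subr_gt0.
rewrite -(@ler_pM2l _ (1 - q))// divff ?gt_eqF//.
have /(congr1 -%R) := subrX1 q N.
rewrite opprB -mulNr opprB => <-.
by rewrite lerBlDr lerDl exprn_ge0.
Qed.

Lemma sum_geometric_int (r : R) (s : seq int) (k : int -> nat) (P : pred int) (F : int -> R) :
  0 < r -> uniq s -> {in P &, injective k} ->
  (forall n, P n -> F n <= expR (- (r * (k n)%:R))) ->
  \sum_(n <- s | P n) F n <= (1 - expR (- r))^-1.
Proof.
move=> r0 us ki kF.
have q1 : expR (- r) < 1 by rewrite -[ltRHS]expR0 ltr_expR oppr_lt0.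
pose t := [seq k n | n <- s & P n].
have ut : uniq t.
  rewrite map_inj_in_uniq ?filter_uniq// => m n; rewrite !mem_filter.
  by move=> /andP[Pm _] /andP[Pn _]; exact: ki.
apply: le_trans (sum_geometric_uniq (expR_ge0 _) q1 ut).
rewrite big_map big_filter; apply: ler_sum => n Pn.
by rewrite -expRM_natr mulNr; exact: kF.
Qed.

(** With tau = e^(- al x), the summand at the cross-over x equals e^(- be x) = tau^(be/al). To the
    right it decays at rate [be], to the left at rate [al - be]; each rate gives one of the two
    geometric series. *)
Lemma sum_min_expR (al be tau : R) (s : seq int) : 0 < be -> be < al -> 0 < tau -> uniq s ->
  \sum_(n <- s) Num.min 1 (tau * expR (al * n%:~R)) * expR (- (be * n%:~R)) <=
  tau `^ (be / al) * ((1 - expR (- be))^-1 + (1 - expR (- (al - be)))^-1).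
Proof.
move=> be0 beal tau0 us.
have al0 : 0 < al by exact: lt_trans beal.
pose x := - ln tau / al.
have tauE : tau = expR (- (al * x)).
  by rewrite /x mulrCA divff ?gt_eqF// mulr1 opprK lnK.
have powE : tau `^ (be / al) = expR (- (be * x)).
  rewrite /powR gt_eqF// {1}tauE expRK; congr expR; field; rewrite gt_eqF//.
rewrite mulrDr (bigID (fun n : int => x <= n%:~R)) /=; apply: lerD.
  apply: (@le_trans _ _ (\sum_(n <- s | x <= n%:~R) expR (- (be * x)) * expR (- (be *
      (n%:~R - x))))).
    apply: ler_sum => n xn.
    rewrite -expRD; apply: (@le_trans _ _ (expR (- (be * n%:~R)))).
      by rewrite ler_piMl ?expR_ge0// ge_min lexx.
    by rewrite ler_expR; lra.
  rewrite -mulr_sumr powE ler_wpM2l ?expR_ge0//.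
  (* The cross-over need not be an integer: rounding it up here, and down on the other side,
     replaces the distance to it by an integer that is no larger. *)
  apply: (sum_geometric_int (k := fun n => `|n - Num.ceil x|%N)) => //.
    by move=> m n; rewrite !unfold_in /= -!ceil_le_int; exact: absz_subr_inj.
  move=> n xn; rewrite ler_expR lerN2 ler_pM2l// natr_absz ger0_norm; last first.
    by rewrite subr_ge0 ceil_le_int.
  by rewrite rmorphB /= lerB// ceil_ge.
apply: (@le_trans _ _ (\sum_(n <- s | ~~ (x <= n%:~R)) expR (- (be * x)) * expR (- ((al -
    be) * (x - n%:~R))))).
  apply: ler_sum => n xn.
  rewrite -expRD; apply: (@le_trans _ _ (tau * expR (al * n%:~R) * expR (- (be * n%:~R)))).
    by rewrite ler_wpM2r ?expR_ge0// ge_min lexx orbT.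
  by rewrite tauE -!expRD ler_expR; lra.
rewrite -mulr_sumr powE ler_wpM2l ?expR_ge0//.
have ab0 : 0 < al - be by rewrite subr_gt0.
apply: (sum_geometric_int (k := fun n => `|Num.floor x - n|%N)) => //.
  move=> m n; rewrite !unfold_in /= -!ltNge => /ltW + /ltW.
  by rewrite -!floor_ge_int; exact: absz_subl_inj.
move=> n; rewrite -ltNge => /ltW xn; rewrite ler_expR lerN2 ler_pM2l// natr_absz ger0_norm;
    last first.
  by rewrite subr_ge0 floor_ge_int.
by rewrite rmorphB /= lerB// floor_le.
Qed.
End geometric_sums.

(** * The exponents alpha and beta *)

Section exponents.
Variables (R : realType) (a1 a2 a3 a4 : R).
Local Notation mu := (@lebesgue_measure R).

(* The asymptotics force sigma n >= e^(- n alpha) for large n, hence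
   e^(- n alpha) < 1. *)
Lemma alphaHT_gt0 (u v : int -> R -> R) (sigma : int -> R) :
  singular_system a1 a2 a3 a4 u v sigma -> (forall n, 0 < sigma n < 1) ->
  0 < alphaHT a1 a2 a3 a4.
Proof.
move=> [_ _ _ _ _ _ [zeta /andP[z0 z1] /eqO_exP[k k0 /= kO]]] s01.
set al := alphaHT _ _ _ _ in kO *.
rewrite ltNge; apply/negP => al0.
have p0 : 0 < 2^-1 - zeta by rewrite subr_gt0.
(* For n >= X the relative error k n^(-1/2 + zeta) is at most 1/2; with alpha <= 0 and sigma n < 1
   the ratio would be below 1/2, an error above 1/2. *)
pose X := (2 * k + 1) `^ (2^-1 - zeta)^-1.
have [n [Xn kn]] : exists n : nat, X <= n%:R /\
   `|sigma n%:Z / (2 * expR (- (n%:R * al))) - 1| <= k * `|n%:R `^ (- 2^-1 + zeta)|.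
  have [N _ NO] := kO.
  exists (maxn N (Num.truncn X).+1); split; last by apply: NO => /=; exact: leq_maxl.
  by apply: le_trans (ltW (truncnS_gt X)) _; rewrite ler_nat leq_maxr.
have k21 : 0 < 2 * k + 1 by lra.
have X0 : 0 < X by rewrite powR_gt0.
have n0 : 0 < n%:R :> R by exact: lt_le_trans Xn.
have h1 : 2 * k + 1 <= n%:R `^ (2^-1 - zeta).
  have -> : 2 * k + 1 = X `^ (2^-1 - zeta).
    by rewrite /X -powRrM mulVf ?gt_eqF// powRr1// ltW.
  by apply: ge0_ler_powR => //; rewrite ?nnegrE; exact: ltW.
have h2 : k * `|n%:R `^ (- 2^-1 + zeta)| <= 2^-1.
  have -> : - 2^-1 + zeta = - (2^-1 - zeta) :> R by ring.
  rewrite powRN ger0_norm ?invr_ge0 ?powR_ge0//.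
  by rewrite ler_pdivrMr ?powR_gt0//; lra.
have /andP[_ sn1] := s01 n%:Z.
have e1 : 1 <= expR (- (n%:R * al)).
  by rewrite -[leLHS]expR0 ler_expR oppr_ge0 mulr_ge0_le0// ltW.
have h3 : sigma n%:Z / (2 * expR (- (n%:R * al))) < 2^-1.
  by rewrite ltr_pdivrMr; lra.
have := le_trans kn h2; rewrite ler_norml => /andP[]; lra.
Qed.

Section inverse_sqrt_quartic.
Hypotheses (a12 : a1 < a2) (a23 : a2 < a3) (a34 : a3 < a4).
Let P := quarticP a1 a2 a3 a4.
Let w x := (Num.sqrt (P x))^-1.

Lemma quarticP_gt0 x : x \in `]a2, a3[ -> 0 < P x.
Proof.
rewrite in_itv/= => /andP[a2x xa3].
have -> : P x = (x - a1) * (x - a2) * ((a3 - x) * (a4 - x)) by rewrite /P /quarticP; ring.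
by rewrite !mulr_gt0// subr_gt0//; [exact: lt_trans a2x|exact: lt_trans a34].
Qed.

Lemma quarticP_le x : x \in `]a2, a3[ -> P x <= ((a4 - a1) ^+ 2) ^+ 2.
Proof.
move: (a12) (a34) => a12' a34'; rewrite in_itv/= => /andP[a2x xa3].
have -> : P x = (x - a1) * (x - a2) * ((a3 - x) * (a4 - x)) by rewrite /P /quarticP; ring.
have h1 : (x - a1) * (x - a2) <= (a4 - a1) ^+ 2 by rewrite expr2 ler_pM//; lra.
have h2 : (a3 - x) * (a4 - x) <= (a4 - a1) ^+ 2 by rewrite expr2 ler_pM//; lra.
by rewrite [leRHS]expr2 ler_pM// mulr_ge0//; lra.
Qed.

(** A crude positive lower bound suffices: it makes the integrals over both parts of []a2, a3[]
    positive, whence the strict inequalities 0 < beta < alpha. *)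
Lemma inv_sqrt_quarticP_ge x : x \in `]a2, a3[ -> ((a4 - a1) ^+ 2)^-1 <= w x.
Proof.
move=> xI; rewrite /w lef_pV2 ?posrE ?sqrtr_gt0 ?quarticP_gt0//; last first.
  by rewrite exprn_gt0// subr_gt0; apply: lt_trans a12 _; exact: lt_trans a23 a34.
have h : Num.sqrt (P x) <= Num.sqrt (((a4 - a1) ^+ 2) ^+ 2).
  by rewrite ler_wsqrtr// quarticP_le.
by rewrite sqrtr_sqr ger0_norm ?sqr_ge0 in h.
Qed.

Lemma measurable_inv_sqrt_quarticP : measurable_fun `]a2, a3[ w.
Proof.
apply: subspace_continuous_measurable_fun; first exact: measurable_itv.
apply: continuous_in_subspaceT => x /[!inE]/= xI.
apply: cvgV; first by rewrite gt_eqF// sqrtr_gt0 quarticP_gt0.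
apply: (@continuous_comp _ _ _ P (@Num.sqrt R)); last exact: sqrt_continuous.
rewrite /P /quarticP.
by repeat (apply: cvgM); apply: cvgB => //; exact: cvg_cst.
Qed.

Lemma integral_inv_sqrt_quarticP_ge p q : a2 <= p -> p < q -> q <= a3 ->
  ((((a4 - a1) ^+ 2)^-1 * (q - p))%:E <= \int[mu]_(x in `]p, q[) (w x)%:E)%E.
Proof.
move=> a2p pq qa3.
have pqS : `]p, q[%classic `<=` `]a2, a3[%classic.
  by apply: subset_itvW; rewrite ?bnd_simp.
have -> : (((a4 - a1) ^+ 2)^-1 * (q - p))%:E = (\int[mu]_(x in `]p, q[) (((a4 - a1) ^+
    2)^-1)%:E)%E.
  rewrite integral_cst//.
  by rewrite [X in (_ * X)%E]lebesgue_measure_itv/= lte_fin pq -EFinB -EFinM.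
apply: ge0_le_integral => //.
- by move=> x _; rewrite lee_fin invr_ge0 sqr_ge0.
- by apply/measurable_EFinP; apply: measurable_funS measurable_inv_sqrt_quarticP => //;
    exact: measurable_itv.
- move=> x xpq; rewrite lee_fin; apply: inv_sqrt_quarticP_ge; exact: pqS.
Qed.

(* As alpha > 0, the integrals [Kplus] and [Kminus] are nonzero, hence finite:
   [fine] maps [+oo] to [0]. *)
Lemma betaHT_bounds mu0 : 0 < mu0 -> mu0 < a3 - a2 -> 0 < alphaHT a1 a2 a3 a4 ->
  0 < betaHT a1 a2 a3 a4 mu0 < alphaHT a1 a2 a3 a4.
Proof.
move=> m0 m1 al0; pose c := a3 - mu0.
have a2c : a2 < c by rewrite /c; lra.
have ca3 : c < a3 by rewrite /c; lra.
have L0 : 0 < ((a4 - a1) ^+ 2)^-1.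
  by rewrite invr_gt0 exprn_gt0// subr_gt0; apply: lt_trans a12 _; exact: lt_trans a23 a34.
have w0 x : (0 <= (w x)%:E)%E by rewrite lee_fin invr_ge0 sqrtr_ge0.
have Km0 : 0 <= Kminus a1 a2 a3 a4 by apply: Rintegral_ge0 => x _; rewrite invr_ge0 sqrtr_ge0.
have Kp0 : 0 <= Kplus a1 a2 a3 a4 by apply: Rintegral_ge0 => x _; rewrite invr_ge0 sqrtr_ge0.
have pi0 := pi_gt0 R.
have {Km0} Km : 0 < Kminus a1 a2 a3 a4.
  rewrite lt_neqAle Km0 andbT eq_sym; apply: contraTneq al0 => K0.
  by rewrite /alphaHT K0 invr0 mulr0 ltxx.
have {Kp0} Kp : 0 < Kplus a1 a2 a3 a4.
  rewrite lt_neqAle Kp0 andbT eq_sym; apply: contraTneq al0 => K0.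
  by rewrite /alphaHT K0 mulr0 mul0r ltxx.
pose I := (\int[mu]_(x in `]a2, a3[) (w x)%:E)%E.
pose J1 := (\int[mu]_(x in `]a2, c[) (w x)%:E)%E.
pose J2 := (\int[mu]_(x in `]c, a3[) (w x)%:E)%E.
have KpI : Kplus a1 a2 a3 a4 = fine I by [].
have Ifin : I \is a fin_num.
  rewrite ge0_fin_numE; last exact: integral_ge0.
  rewrite ltNge leye_eq; apply/negP => /eqP Iy.
  by move: Kp; rewrite KpI Iy ltxx.
have s1 : `]a2, c[%classic `<=` `]a2, a3[%classic by apply: subset_itvW;
    rewrite ?bnd_simp// ltW.
have s2 : `]c, a3[%classic `<=` `]a2, a3[%classic by apply: subset_itvW;
    rewrite ?bnd_simp// ltW.
have mw : measurable_fun `]a2, a3[ (EFin \o w).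
  by apply/measurable_EFinP; exact: measurable_inv_sqrt_quarticP.
have J12 : (J1 + J2 <= I)%E.
  rewrite -ge0_integral_setU//=.
  - apply: ge0_subset_integral => //; first exact: measurableU.
    by move=> x [/s1|/s2].
  - by apply: measurable_funS mw => //; move=> x [/s1|/s2].
  - apply/disj_setPS => x [/=]; rewrite !in_itv/= => /andP[_ xc] /andP[cx _].
    by move: (lt_trans xc cx); rewrite ltxx.
have J1g : ((((a4 - a1) ^+ 2)^-1 * (c - a2))%:E <= J1)%E by apply:
    integral_inv_sqrt_quarticP_ge => //; exact: ltW.
have J2g : ((((a4 - a1) ^+ 2)^-1 * (a3 - c))%:E <= J2)%E by apply:
    integral_inv_sqrt_quarticP_ge => //; exact: ltW.
have J10 : (0 <= J1)%E by exact: integral_ge0.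
have J20 : (0 <= J2)%E by exact: integral_ge0.
have J1fin : J1 \is a fin_num.
  rewrite ge0_fin_numE//; apply: le_lt_trans (_ : (I < +oo)%E); last by rewrite ltey_eq Ifin.
  by apply: le_trans J12; exact: leeDl.
have J2fin : J2 \is a fin_num.
  rewrite ge0_fin_numE//; apply: le_lt_trans (_ : (I < +oo)%E); last by rewrite ltey_eq Ifin.
  by apply: le_trans J12; exact: leeDr.
move: J1g J2g J12; rewrite -(fineK J1fin) -(fineK J2fin) -(fineK Ifin) -EFinD !lee_fin =>
    J1g J2g J12.
have j1 : 0 < fine J1 by apply: lt_le_trans J1g; rewrite mulr_gt0// subr_gt0.
have j2 : 0 < fine J2 by apply: lt_le_trans J2g; rewrite mulr_gt0// subr_gt0.
have -> : betaHT a1 a2 a3 a4 mu0 = pi / Kminus a1 a2 a3 a4 * fine J2 by [].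
have -> : alphaHT a1 a2 a3 a4 = pi / Kminus a1 a2 a3 a4 * fine I by rewrite -KpI /alphaHT
    mulrAC.
have piK : 0 < pi / Kminus a1 a2 a3 a4 by exact: divr_gt0.
by rewrite mulr_gt0//= ltr_pM2l//; apply: lt_le_trans J12; rewrite ltrDr.
Qed.

End inverse_sqrt_quartic.

End exponents.

(** * The stability estimate *)

Section norm_chi.
Variables (R : realType) (a2 a3 a4 mu : R).
Implicit Types f g : R -> R.
Local Notation nchi := (norm_chi a2 a3 a4 mu).
Let chi : R -> R := \1_(`]a2, a3 - mu[%classic).

Let normr_chiM f x : `|chi x * f x| <= `|f x|.
Proof.
rewrite normrM ler_piMl// /chi indicE.
by case: (_ \in _); rewrite ?normr1 ?normr0.
Qed.

Lemma L2_chiM f : L2 a2 a4 f -> L2 a2 a4 (fun x => chi x * f x).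
Proof.
move=> Lf; apply: L2_le (Lf) (normr_chiM f).
apply: measurable_funM; last exact: L2_measurable Lf.
by apply: measurable_indic; exact: measurable_itv.
Qed.

Lemma norm_chi_le f : L2 a2 a4 f -> (nchi f <= normL2 a2 a4 f)%E.
Proof.
move=> Lf; have Lcf := L2_chiM Lf.
rewrite /norm_chi -/chi !normL2E// lee_fin ler_wsqrtr//.
apply: le_Rintegral => //; [exact: L2_integrableM|exact: L2_integrableM|].
move=> x _; rewrite -!expr2 -[leLHS]real_normK ?num_real// -[leRHS]real_normK ?num_real//.
by rewrite ler_pXn2r ?nnegrE.
Qed.

Lemma norm_chiD f g : L2 a2 a4 f -> L2 a2 a4 g ->
  (nchi (fun x => f x + g x)%R <= nchi f + nchi g)%E.
Proof.
move=> Lf Lg; apply: le_trans (normL2D (L2_chiM Lf) (L2_chiM Lg)).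
rewrite /norm_chi (_ : (fun x => _ * (f x + g x)) = (fun x => chi x * f x + chi x * g x))//.
by apply/funext => x; rewrite mulrDr.
Qed.

Lemma norm_chiZ (c : R) f : L2 a2 a4 f ->
  (nchi (fun x => c * f x)%R = `|c|%:E * nchi f)%E.
Proof.
move=> Lf; rewrite -(normL2Z c (L2_chiM Lf)) /norm_chi; congr normL2.
by apply/funext => x; rewrite mulrCA.
Qed.

(** Multiplication by chi destroys orthogonality, so the high modes are summed by the triangle
    inequality, with absolute values rather than squares. *)
Lemma norm_chi_sum (I : eqType) (s : seq I) (c : I -> R) (e : I -> R -> R) (B : I -> R) :
  (forall n, L2 a2 a4 (e n)) -> (forall n, n \in s -> (nchi (e n) <= (B n)%:E)%E) ->
  (nchi (fun x => \sum_(n <- s) c n * e n x)%R <= (\sum_(n <- s) `|c n| * B n)%:E)%E.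
Proof.
move=> Le; elim: s => [|n s IH] eB.
  (* The zero function is written as a multiple so that homogeneity yields its norm. *)
  rewrite big_nil (_ : (fun x => _) = (fun x => 0 * 0)); last first.
    by apply/funext => x; rewrite big_nil mul0r.
  by rewrite (norm_chiZ _ (L2_cst _ _ 0)) normr0 mul0e.
rewrite (_ : (fun x => _) = (fun x => c n * e n x + \sum_(n <- s) c n * e n x)%R); last first.
  by apply/funext => x; rewrite big_cons.
apply: (le_trans (norm_chiD (L2Z _ (Le n)) (L2_sum s c Le))).
rewrite big_cons EFinD; apply: leeD; last first.
  by apply: IH => m ms; apply: eB; rewrite inE ms orbT.
by rewrite norm_chiZ// EFinM lee_wpmul2l// ?lee_fin// eB// mem_head.
Qed.

End norm_chi.

Section reconstruction_bound.
Variables (R : realType) (a1 a2 a3 a4 mu : R) (u v : int -> R -> R) (sigma : int -> R).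
Variables (Nmu : nat) (A B al be : R).
Hypotheses (a24 : a2 < a4) (onbu : orthonormal_basis a2 a4 u)
  (onbv : orthonormal_basis a1 a3 v)
  (uv : forall n, is_HT a1 a2 a3 a4 (u n) (fun x => sigma n * v n x))
  (sdec : {homo sigma : m n / m <= n >-> n <= m}).
Hypotheses (A0 : 0 < A) (B0 : 0 < B) (be0 : 0 < be) (beal : be < al).
Hypothesis sigma_ge : forall n : nat, (Nmu <= n)%N -> A * expR (- (al * n%:R)) <= sigma n%:Z.
Hypothesis chi_u : forall n : nat, (Nmu < n)%N ->
    (norm_chi a2 a3 a4 mu (u n%:Z) <= (B * expR (- (be * n%:R)))%:E)%E.

Lemma norm_chi_bound (E delta : R) f h : 0 < E -> 0 < delta ->
  L2 a2 a4 f -> is_HT a1 a2 a3 a4 f h ->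
  ipL2 a2 a4 f f <= (2 * E) ^+ 2 -> ipL2 a1 a3 h h <= (2 * delta) ^+ 2 ->
  (norm_chi a2 a3 a4 mu f <=
   (2 * delta * expR (al * Nmu%:R) / A + 2 * E * B * ((delta / (A * E)) `^ (be / al) *
     ((1 - expR (- be))^-1 + (1 - expR (- (al - be)))^-1)))%:E)%E.
Proof.
move=> E0 delta0 Lf fh fE hd.
have [Lu ou _] := onbu; have [Lv ov _] := onbv.
have Lh : L2 a1 a3 h by case: fh.
pose c n := ipL2 a2 a4 f (u n).
have hc n : ipL2 a1 a3 h (v n) = sigma n * c n by exact: (HT_coef a24 onbu onbv uv).
apply/lee_addgt0Pr => eps eps0.
have [s us fs] := onb_approximation onbu Lf eps0.
pose P (n : int) := n <= Nmu%:Z.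
pose s1 := [seq n <- s | P n]; pose s2 := [seq n <- s | ~~ P n].
have us1 : uniq s1 by rewrite filter_uniq.
have us2 : uniq s2 by rewrite filter_uniq.
have fE2 : f = (fun x => (f x - lincomb u s c x) + (lincomb u s1 c x + lincomb u s2 c x)).
  apply/funext => x; rewrite /lincomb !big_filter.
  by rewrite [X in _ = (_ - X) + _](bigID P) /= subrK.
have LS t : L2 a2 a4 (lincomb u t c) by exact: L2_lincomb.
rewrite [in leLHS]fE2 addeC.
apply: (le_trans (norm_chiD _ _ (L2B Lf (LS s)) (L2D (LS s1) (LS s2)))).
apply: leeD; first exact: le_trans (norm_chi_le _ _ (L2B Lf (LS s))) fs.
apply: (le_trans (norm_chiD _ _ (LS s1) (LS s2))).
rewrite EFinD; apply: leeD.
- apply: (le_trans (norm_chi_le _ _ (LS s1))).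
  have eA0 : 0 <= expR (al * Nmu%:R) / A by rewrite divr_ge0 ?expR_ge0 ?(ltW A0).
  have ed0 : 0 <= 2 * delta * (expR (al * Nmu%:R) / A) by rewrite mulr_ge0// mulr_ge0// ltW.
  rewrite -mulrA normL2_leP//.
  rewrite (ip_lincomb_sqr Lu ou _ us1).
  rewrite exprMn mulrC.
  apply: (@le_trans _ _ ((expR (al * Nmu%:R) / A) ^+ 2 * \sum_(n <- s1) ipL2 a1 a3 h (v n)
      ^+ 2)); last first.
    by rewrite ler_wpM2l ?sqr_ge0//; apply: le_trans (Bessel Lv ov us1 Lh) hd.
  rewrite mulr_sumr big_seq [leRHS]big_seq; apply: ler_sum => n.
  rewrite mem_filter => /andP[Pn _].
  rewrite hc -exprMn -[leLHS]real_normK ?num_real// -[leRHS]real_normK ?num_real//.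
  rewrite ler_pXn2r ?nnegrE// mulrA normrM ler_peMl//.
  have sn : A * expR (- (al * Nmu%:R)) <= sigma n by apply: le_trans (sdec Pn); exact: sigma_ge.
  apply: le_trans (ler_norm _).
  apply: (@le_trans _ _ (expR (al * Nmu%:R) / A * (A * expR (- (al * Nmu%:R))))).
    by rewrite mulrA divfK ?gt_eqF// -expRD subrr expR0.
  by rewrite ler_wpM2l.
- have s2P n : n \in s2 -> exists2 m : nat, n = m%:Z & (Nmu < m)%N.
    rewrite mem_filter /P -ltNge => /andP[Pn _].
    case: n Pn => // m Pn; exists m => //.
  have eB n : n \in s2 -> (norm_chi a2 a3 a4 mu (u n) <= (B * expR (- (be * n%:~R)))%:E)%E.
    by move=> /s2P[m -> mN]; exact: chi_u.
  apply: (le_trans (norm_chi_sum c Lu eB)); rewrite lee_fin.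
  have tau0 : 0 < delta / (A * E) by rewrite divr_gt0// mulr_gt0.
  have EB0 : 0 <= 2 * E * B by rewrite !mulr_ge0// ltW.
  apply: le_trans (ler_wpM2l EB0 (sum_min_expR be0 beal tau0 us2)).
  rewrite mulr_sumr big_seq [leRHS]big_seq; apply: ler_sum => n ns.
  rewrite mulrA [leRHS]mulrA ler_wpM2r ?expR_ge0// -[leRHS]mulrA [B * _]mulrC mulrA
      ler_wpM2r ?(ltW B0)//.
  have c1 : `|c n| <= 2 * E.
    apply: (le_trans (normr_ip_basis Lu ou n Lf)).
    by rewrite -[leRHS]ger0_norm ?mulr_ge0 ?(ltW E0)// -sqrtr_sqr ler_wsqrtr.
  have c2 : `|sigma n| * `|c n| <= 2 * delta.
    rewrite -normrM -hc; apply: (le_trans (normr_ip_basis Lv ov n Lh)).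
    by rewrite -[leRHS]ger0_norm ?mulr_ge0 ?(ltW delta0)// -sqrtr_sqr ler_wsqrtr.
  have [m nm mN] := s2P _ ns.
  have sn : A * expR (- (al * n%:~R)) <= `|sigma n|.
    by apply: le_trans (ler_norm _); rewrite nm; apply: sigma_ge; exact: ltnW.
  rewrite /Num.min; case: ifP => _; first by rewrite mulr1.
  have -> : 2 * E * (delta / (A * E) * expR (al * n%:~R)) = 2 * delta / (A * expR (- (al *
      n%:~R))).
    by rewrite expRN; field; rewrite !gt_eqF ?expR_gt0.
  rewrite ler_pdivlMr ?mulr_gt0 ?expR_gt0//; apply: le_trans c2.
  by rewrite mulrC ler_wpM2r.
Qed.
End reconstruction_bound.

Section constant.
Variables (R : realType) (al be : R).
Hypotheses (be0 : 0 < be) (beal : be < al).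
Let K := (1 - expR (- be))^-1 + (1 - expR (- (al - be)))^-1.
Let L := al / ((al - be) * Num.sqrt (expR (2 * be) - 1)).

(* [K] bounds the geometric sums, [L] is the factor in the statement, and the
   constant [V] solves V^(- be / al) * L = K. *)
Definition rate_constant : R := (L / K) `^ (al / be).

Let L0 : 0 < L.
Proof.
apply: divr_gt0; first exact: lt_trans beal.
apply: mulr_gt0; rewrite ?subr_gt0// sqrtr_gt0 subr_gt0.
by rewrite -[ltLHS]expR0 ltr_expR mulr_gt0.
Qed.

Let K0 : 0 < K.
Proof.
by apply: addr_gt0; rewrite invr_gt0 subr_gt0 -[ltRHS]expR0 ltr_expR oppr_lt0// subr_gt0.
Qed.

Lemma rate_constant_gt0 : 0 < rate_constant.
Proof. by rewrite powR_gt0// divr_gt0. Qed.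

Lemma rate_constantE (A E delta : R) : 0 < A -> 0 < E -> 0 < delta ->
  (delta / (A * rate_constant * E)) `^ (be / al) * L = (delta / (A * E)) `^ (be / al) * K.
Proof.
move=> A0 E0 d0; have V0 := rate_constant_gt0.
have -> : delta / (A * rate_constant * E) = delta / (A * E) * rate_constant^-1.
  by field; rewrite !gt_eqF.
rewrite powRM ?invr_ge0 ?(ltW V0)//; last by rewrite divr_ge0 ?mulr_ge0// ltW.
rewrite -mulrA /rate_constant -powRN -powRrM; congr (_ * _).
have -> : - (al / be) * (be / al) = -1.
  by field; rewrite !gt_eqF// (lt_trans be0).
rewrite powR_inv1; last exact: divr_ge0 (ltW L0) (ltW K0).
by rewrite invf_div divfK ?gt_eqF.
Qed.

End constant.

(** * Differences of admissible solutions and the conclusion *)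

Lemma normL2B (R : realType) (a b : R) (f g : R -> R) : L2 a b f -> L2 a b g ->
  (normL2 a b (fun x => f x - g x)%R <= normL2 a b f + normL2 a b g)%E.
Proof.
move=> Lf Lg.
have -> : (fun x => f x - g x) = (fun x => f x + -1 * g x).
  by apply/funext => x; rewrite mulN1r.
apply: (le_trans (normL2D Lf (L2Z _ Lg))).
by rewrite normL2Z// normrN1 mul1e.
Qed.

(** The measurement [g] cancels between the two residuals; the factors 2 come from the triangle
    inequality. *)
Lemma admissible_sub (R : realType) (a1 a2 a3 a4 delta E : R) (g f_a f_b : R -> R) :
  0 < delta -> 0 < E -> L2 a1 a3 g ->
  admissible a1 a2 a3 a4 delta E g f_a -> admissible a1 a2 a3 a4 delta E g f_b ->
  let f := fun x => f_a x - f_b x in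
  [/\ L2 a2 a4 f, ipL2 a2 a4 f f <= (2 * E) ^+ 2 &
    exists2 h, is_HT a1 a2 a3 a4 f h & ipL2 a1 a3 h h <= (2 * delta) ^+ 2].
Proof.
move=> d0 E0 Lg [La [ha fha hag] faE] [Lb [hb fhb hbg] fbE] /=.
have Lha : L2 a1 a3 ha by case: fha.
have Lhb : L2 a1 a3 hb by case: fhb.
have Lf := L2B La Lb.
have E2 : 0 <= 2 * E by rewrite mulr_ge0// ltW.
have d2 : 0 <= 2 * delta by rewrite mulr_ge0// ltW.
split => //.
  rewrite -normL2_leP//.
  by apply: (le_trans (normL2B La Lb)); rewrite mulr2n mulrDl mul1r EFinD leeD.
exists (fun x => ha x - hb x); first exact: is_HTB.
rewrite -normL2_leP//; last exact: L2B.
have -> : (fun x => ha x - hb x) = (fun x => (ha x - g x) - (hb x - g x)).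
  by apply/funext => x; ring.
apply: (le_trans (normL2B (L2B Lha Lg) (L2B Lhb Lg))).
by rewrite mulr2n mulrDl mul1r EFinD leeD.
Qed.

Theorem proposition1 (R : realType) :
  exists V : R -> R -> R,
  (forall alpha beta, 0 < beta -> beta < alpha -> 0 < V alpha beta) /\
  forall (a1 a2 a3 a4 mu : R) (u v : int -> R -> R) (sigma : int -> R)
    (N0 Nmu : nat) (A Bmu : R),
  a1 < a2 -> a2 < a3 -> a3 < a4 ->
  0 < mu -> mu < a3 - a2 ->
  let alpha := alphaHT a1 a2 a3 a4 in
  let beta := betaHT a1 a2 a3 a4 mu in
  singular_system a1 a2 a3 a4 u v sigma ->
  (forall n, 0 < sigma n < 1) ->
  0 < A -> A < 2 ->
  (forall n : nat, (N0 < n)%N -> A * expR (- (alpha * n%:R)) <= sigma n%:Z) ->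
  (N0 < Nmu)%N -> 0 < Bmu ->
  (forall n : nat, (Nmu < n)%N ->
    (norm_chi a2 a3 a4 mu (u n%:Z) <= (Bmu * expR (- (beta * n%:R)))%:E)%E) ->
  (forall Alg, computes_admissible a1 a2 a3 a4 Alg ->
    regularization_method a1 a2 a3 a4 mu Alg) /\
  (forall E : R, 0 < E ->
    exists2 delta0 : R, 0 < delta0 &
    forall delta : R, 0 < delta -> delta < delta0 ->
    forall f_ex g_ex g : R -> R,
    measurement a1 a2 a3 a4 delta E f_ex g_ex g ->
    forall f_a f_b : R -> R,
    admissible a1 a2 a3 a4 delta E g f_a ->
    admissible a1 a2 a3 a4 delta E g f_b ->
    (norm_chi a2 a3 a4 mu (fun x => f_a x - f_b x)%R <=
      (2 * delta * expR (alpha * Nmu%:R) / A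
       + 2 * E * Bmu * (delta / (A * V alpha beta * E)) `^ (beta / alpha)
         * (alpha / ((alpha - beta) * Num.sqrt (expR (2 * beta) - 1))))%:E)%E).
Proof.
exists (@rate_constant R); split; first exact: rate_constant_gt0.
move=> a1 a2 a3 a4 mu u v sigma N0 Nmu A Bmu a12 a23 a34 m0 m1 alpha beta.
move=> ss s01 A0 A2 sge NN B0 chiu.
have al0 : 0 < alpha := alphaHT_gt0 ss s01.
have /andP[be0 beal] : 0 < beta < alpha by exact: betaHT_bounds.
have a24 : a2 < a4 := lt_trans a23 a34.
have bound E delta g f_a f_b : 0 < E -> 0 < delta -> L2 a1 a3 g ->
    admissible a1 a2 a3 a4 delta E g f_a -> admissible a1 a2 a3 a4 delta E g f_b ->
    (norm_chi a2 a3 a4 mu (fun x => f_a x - f_b x)%R <=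
      (2 * delta * expR (alpha * Nmu%:R) / A
       + 2 * E * Bmu * (delta / (A * rate_constant alpha beta * E)) `^ (beta / alpha)
         * (alpha / ((alpha - beta) * Num.sqrt (expR (2 * beta) - 1))))%:E)%E.
  move=> E0 d0 Lg fa fb.
  have [Lf fE [h fh hd]] := admissible_sub d0 E0 Lg fa fb.
  rewrite -[X in (_ <= (_ + X)%:E)%E]mulrA rate_constantE//.
  case: ss => onbu onbv uv sdec _ _ _.
  (* The low modes are controlled through sigma at the index [Nmu] itself, hence the non-strict
     inequality, which N0 < Nmu supplies. *)
  have sge' n : (Nmu <= n)%N -> A * expR (- (alpha * n%:R)) <= sigma n%:Z.
    by move=> Nn; apply: sge; exact: leq_trans Nn.
  exact: (norm_chi_bound a24 onbu onbv uv sdec A0 B0 be0 beal sge' chiu E0 d0 Lf fh fE hd).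
split; last first.
  (* [bound] covers every positive [delta], so the threshold 1 is an arbitrary choice. *)
  move=> E E0; exists 1 => // delta d0 _ f_ex g_ex g [_ _ _ Lg _] f_a f_b fa fb.
  exact: bound Lg fa fb.
move=> Alg Algadm E f_ex g_ex g E0 meas.
pose bd delta := 2 * delta * expR (alpha * Nmu%:R) / A
       + 2 * E * Bmu * (delta / (A * rate_constant alpha beta * E)) `^ (beta / alpha)
         * (alpha / ((alpha - beta) * Num.sqrt (expR (2 * beta) - 1))).
apply: (@squeeze_cvge _ _ _ _ (fun=> 0%E) _ (EFin \o bd)).
- near=> delta.
  have d0 : 0 < delta by near: delta; exact: nbhs_right_gt.
  rewrite Lnorm_ge0 /=.
  have [Lf fg fE Lg gd] := meas _ d0.
  (* The exact solution is itself admissible. This makes the admissible set nonempty, so the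
     algorithm returns one of its elements, and the stability bound compares that element with
     [f_ex]. *)
  have fadm : admissible a1 a2 a3 a4 delta E (g delta) f_ex.
    split => //; exists g_ex => //.
    have Lge : L2 a1 a3 g_ex by case: fg.
    rewrite (_ : (fun x => _) = (fun x => -1 * (g delta x - g_ex x))); last first.
      by apply/funext => x; ring.
    by rewrite normL2Z ?normrN1 ?mul1e//; exact: L2B.
  by apply: (bound _ _ _ _ _ E0 d0 Lg _ fadm); apply: Algadm => //; exists f_ex.
- exact: cvg_cst.
- apply: cvg_EFin; first exact: nearW.
  have V0 : 0 < rate_constant alpha beta by exact: rate_constant_gt0.
  have c0 : 0 < (A * rate_constant alpha beta * E)^-1 by rewrite invr_gt0 !mulr_gt0.
  have p0 : 0 < beta / alpha by rewrite divr_gt0.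
  have id0 : (delta : R) @[delta --> 0^'+] --> (0 : R) by exact: cvg_at_right_filter.
  have h1 : 2 * delta * expR (alpha * Nmu%:R) / A @[delta --> 0^'+] -->
      2 * 0 * expR (alpha * Nmu%:R) / A.
    by apply: cvgM; [apply: cvgM; [apply: cvgM; [exact: cvg_cst|exact: id0]|]|]; exact: cvg_cst.
  (* The power of the product splits for nonnegative [delta], which holds near 0 from the right;
     what remains is the limit 0 of a positive power of [delta]. *)
  pose c := (A * rate_constant alpha beta * E)^-1 `^ (beta / alpha).
  have h2 : delta `^ (beta / alpha) * c @[delta --> 0^'+] --> 0 * c.
    by apply: cvgM; [exact: powR_cvg0|exact: cvg_cst].
  have h3 : (delta / (A * rate_constant alpha beta * E)) `^ (beta / alpha) @[delta -->
      0^'+] --> 0 * c.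
    apply: cvg_trans h2; apply: near_eq_cvg; near=> delta.
    by rewrite powRM// ltW.
  pose M := alpha / ((alpha - beta) * Num.sqrt (expR (2 * beta) - 1)).
  have h4 : bd delta @[delta --> 0^'+] -->
      2 * 0 * expR (alpha * Nmu%:R) / A + 2 * E * Bmu * (0 * c) * M.
    apply: cvgD h1 _; apply: cvgM; last exact: cvg_cst.
    by apply: cvgM h3; exact: cvg_cst.
  by move: h4; rewrite mul0r !mulr0 !mul0r addr0.
Unshelve. all: by end_near.
Qed.
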